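(* Let $(X,\mathcal{M})$ be a hyperbolic space with walls, with associated graph $\mathcal{G}$, and let $G$ be a group of automorphisms of $(X,\mathcal{M})$ whose action on $\mathcal{G}$ is non-elementary with limit set equal to $\partial\mathcal{G}$. Suppose that $G$ satisfies property (P). Let $G^+$ be the subgroup of $G$ generated by the strict fixators (in $G$) of proper walls, and let $H$ be a normal subgroup of $G^+$. Then either $H$ is contained in the kernel of the action of $G^+$ on $\partial\mathcal{G}$, or $H=G^+$.
   Context: A wall of a set $X$ is a partition of $X$ into two subsets, called its half-spaces; it separates $x$ and $y$ if they lie in different half-spaces. A space with walls is a set $X$ with a set $\mathcal{M}$ of walls of $X$ such that for all distinct $x,y\in X$ the set $\mathcal{M}(x,y)$ of walls of $\mathcal{M}$ separating $x$ and $y$ is finite and non-empty. A point $z$ is between $x$ and $y$ if $\mathcal{M}(x,y)=\mathcal{M}(x,z)\cup\mathcal{M}(z,y)$. The associated graph $\mathcal{G}$ has vertex set $X$, with an edge between $x\neq y$ if and only if the only points of $X$ between $x$ and $y$ are $x$ and $y$; it is connected and metrized with edges of length $1$. A wall is transverse to an edge of $\mathcal{G}$ if it separates its endpoints. $(X,\mathcal{M})$ is hyperbolic if $\mathcal{G}$ is Gromov-hyperbolic and, for every $\xi\in\partial\mathcal{G}$, the sets $\overline A$ (closure in $\mathcal{G}\cup\partial\mathcal{G}$), where $A$ runs over the half-spaces such that $\overline A$ contains $\xi$ in its interior, form a neighbourhood basis of $\xi$ in $\mathcal{G}\cup\partial\mathcal{G}$. A wall is proper if, for each of its half-spaces $A$,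 $\partial A=\overline A\cap\partial\mathcal{G}$ is not all of $\partial\mathcal{G}$. An automorphism of $(X,\mathcal{M})$ is a bijection of $X$ preserving $\mathcal{M}$; it acts on $\mathcal{G}$ and on $\partial\mathcal{G}$. It strictly fixes a wall $M$ if it fixes the endpoints of every edge of $\mathcal{G}$ transverse to $M$; it then preserves each half-space of $M$. The strict fixator of $M$ in $G$ is the subgroup $G_M$ of elements of $G$ strictly fixing $M$. Property (P). For a wall $M=\{A,X\setminus A\}$ in $\mathcal{M}$ let $G_A$ and $G_{X\setminus A}$ be the permutation groups of $A$ and $X\setminus A$ induced by $G_M$. A chain is a sequence $C=(A_i)_{i\in\mathbb{Z}}$ of half-spaces strictly decreasing for inclusion; let $G_C$ be the subgroup of elements of $G$ strictly fixing every wall $\{A_i,X\setminus A_i\}$, and let $G_{C,i}$ be the permutation group of $A_i\setminus A_{i+1}$ induced by $G_C$. $G$ satisfies (P) if for every wall $M$ and every chain $C$ the restriction morphisms $G_M\to G_A\times G_{X\setminus A}$ and $G_C\to\prod_{i\in\mathbb{Z}}G_{C,i}$ are surjective (they are always injective). Let $Y$ be a complete geodesic Gromov-hyperbolic space such that any two points of $Y\cup\partial Y$ are joined by a geodesic segment, ray or line (automatic if $Y$ is locally compact). An isometry $g$ is hyperbolic if $k\mapsto g^kx$ is a quasi-isometric embedding of $\mathbb{Z}$. For a group $G$ of isometries of $Y$, the limit set $\Lambda G$ is the closure in $\partial Y$ of the set of fixed points in $\partial Y$ of hyperbolic elements of $G$; $G$ is non-elementary if $\Lambda G$ contains at least three points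 and contains no global fixed point of $G$. These notions are applied with $Y=\mathcal{G}$. *)

(* Defs.v *)
From HB Require Import structures.
From mathcomp Require Import all_boot all_order all_algebra finmap.
From mathcomp Require Import all_classical all_reals all_analysis.

Set Implicit Arguments.
Unset Strict Implicit.
Unset Printing Implicit Defensive.

Import Order.TTheory GRing.Theory Num.Theory.

Local Open Scope classical_set_scope.
Local Open Scope ring_scope.

(** ** Subgroups of a (possibly infinite) group *)

Section Groups.
Variable gT : groupType.
Implicit Types (H K S : set gT) (g : gT).

Definition subgroup H : Prop :=
  [/\ H 1%g, forall g h, H g -> H h -> H (g * h)%g & forall g, H g -> H g^-1%g].

Definition normal_subgroup H K : Prop :=
  [/\ subgroup H, H `<=` K & forall h k, H h -> K k -> H (h ^ k)%g].

Definition generated S : set gT := smallest subgroup S.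

Definition expgz g (k : int) : gT :=
  match k with Posz n => (g ^+ n)%g | Negz n => (g ^- n.+1)%g end.

End Groups.

(** ** Gromov-hyperbolic metric spaces and their boundary *)

Section Gromov.
Context {R : realType}.

Definition gromov_product {Y : metricType R} (o x y : Y) : R :=
  (mdist o x + mdist o y - mdist x y) / 2.

Definition gromov_hyperbolic (Y : metricType R) : Prop :=
  exists delta : R, forall o x y z : Y,
    Num.min (gromov_product o x y) (gromov_product o y z) - delta
      <= gromov_product o x z.

Section Boundary.
Variable Y : metricType R.
Implicit Types u v : nat -> Y.

(* [(u_i | v_j)_o] tends to [+oo] as [i, j] tend to [+oo]. *)
Definition product_to_infinity u v : Prop :=
  forall o : Y,
    gromov_product o (u ij.1) (v ij.2) @[ij --> (\oo, \oo)] --> +oo.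

Definition converges_at_infinity u : Prop := product_to_infinity u u.

(* The equivalence class of [u] among the sequences converging at infinity. *)
Definition boundary_class u : set (nat -> Y) :=
  [set v | converges_at_infinity v /\ product_to_infinity u v].

Definition boundary : Type :=
  {C : set (nat -> Y) |
    exists2 u, converges_at_infinity u & C = boundary_class u}.

Variant bordification : Type :=
| Inner of Y
| Ideal of boundary.

Definition represents u (z : bordification) : Prop :=
  match z with
  | Inner y => u = fun=> y
  | Ideal xi => sval xi u
  end.

(* The product [(z | w)_o] extended to [Y U dY] as a supremum, over the
   representatives [u] of [z] and [v] of [w], of [liminf_(i, j) (u_i | v_j)_o];
   the relation below says that some liminf is at least [r]. *)
Definition product_ge (o : Y) (z w : bordification) (r : R) : Prop :=
  exists u v, [/\ represents u z, represents v w &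
    forall s, s < r ->
      \forall i \near \oo & j \near \oo, s <= gromov_product o (u i) (v j)].

(* The usual topology of [Y U dY]: [Y] is open with its metric topology, and the
   sets of all [z] with [(xi | z)_o >= r] are basic neighbourhoods of [xi]. *)
Definition bordification_open (U : set bordification) : Prop :=
  (forall y, U (Inner y) -> \forall y' \near y, U (Inner y')) /\
  (forall xi, U (Ideal xi) -> forall o : Y, exists r : R,
     [set z | product_ge o (Ideal xi) z r] `<=` U).

HB.instance Definition _ := gen_eqMixin bordification.
HB.instance Definition _ := gen_choiceMixin bordification.

Let bordification_openT : bordification_open setT.
Proof. by split=> [y _|xi _ o]; [exact: filterT|exists 0]. Qed.

Lemma product_geW o z w r s : s <= r -> product_ge o z w r -> product_ge o z w s.
Proof.
move=> sr [u [v [uz vw h]]]; exists u, v; split=> // t ts.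
by apply: h; exact: lt_le_trans ts sr.
Qed.

Let bordification_openI (U V : set bordification) :
  bordification_open U -> bordification_open V -> bordification_open (U `&` V).
Proof.
move=> [U1 U2] [V1 V2]; split=> [y [Uy Vy]|xi [Uxi Vxi] o].
  by apply: filterI; [exact: U1|exact: V1].
have [r hr] := U2 _ Uxi o; have [s hs] := V2 _ Vxi o.
exists (Num.max r s) => z /= hz; split.
- by apply: hr; apply: product_geW hz; rewrite le_max lexx.
- by apply: hs; apply: product_geW hz; rewrite le_max lexx orbT.
Qed.

Let bordification_open_bigU (I : Type) (F : I -> set bordification) :
  (forall i, bordification_open (F i)) -> bordification_open (\bigcup_i F i).
Proof.
move=> hF; split=> [y [i _ Fy]|xi [i _ Fxi] o].
  by apply: filterS ((hF i).1 _ Fy) => y' ?; exists i.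
have [r hr] := (hF i).2 _ Fxi o.
by exists r => z /hr ?; exists i.
Qed.

HB.instance Definition _ := isOpenTopological.Build bordification
  bordification_openT bordification_openI bordification_open_bigU.

(** *** Geodesics *)

(* [c], restricted to the interval [I], is an isometric embedding. *)
Definition isometric_on (I : set R) (c : R -> Y) : Prop :=
  forall s t, I s -> I t -> mdist (c s) (c t) = `|s - t|.

Definition joined_by_geodesics : Prop :=
  [/\ forall x y : Y, exists c : R -> Y,
        [/\ isometric_on `[0, mdist x y] c, c 0 = x & c (mdist x y) = y],
      forall (x : Y) (xi : boundary), exists c : R -> Y,
        [/\ isometric_on `[0, +oo[ c, c 0 = x & sval xi (fun n => c n%:R)] &
      forall xi eta : boundary, xi <> eta -> exists c : R -> Y,
        [/\ isometric_on setT c, sval xi (fun n => c (- n%:R)) &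
            sval eta (fun n => c n%:R)]].

(** *** Groups of isometries *)

Definition quasi_isometric_embedding (f : int -> Y) : Prop :=
  exists lambda c : R, 1 <= lambda /\ forall k l : int,
    lambda^-1 * `|k - l|%:~R - c <= mdist (f k) (f l) <= lambda * `|k - l|%:~R + c.

Section Action.
(* [act] is meant to be an action by isometries of the group [gT] on [Y]. *)
Variables (gT : groupType) (act : gT -> Y -> Y).
Implicit Types (g : gT) (G : set gT) (xi : boundary).

Definition hyperbolic_element g : Prop :=
  forall x : Y, quasi_isometric_embedding (fun k => act (expgz g k) x).

(* [g xi = xi], for the action of [g] on classes of sequences. *)
Definition fixes_ideal g xi : Prop :=
  [set (fun n => act g (u n)) | u in sval xi] = sval xi.

(* The closure in [dY] for the topology induced by [Y U dY]. *)
Definition limit_set G : set boundary :=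
  Ideal @^-1` closure
    [set Ideal xi | xi in
      [set xi | exists g, [/\ G g, hyperbolic_element g & fixes_ideal g xi]]].

Definition non_elementary G : Prop :=
  (exists xi1 xi2 xi3 : boundary,
     [/\ limit_set G xi1, limit_set G xi2 & limit_set G xi3] /\
     [/\ xi1 <> xi2, xi1 <> xi3 & xi2 <> xi3]) /\
  ~ exists2 xi, limit_set G xi & forall g, G g -> fixes_ideal g xi.

Definition boundary_kernel G : set gT :=
  [set g | G g /\ forall xi, fixes_ideal g xi].

End Action.
End Boundary.
End Gromov.

(** ** Spaces with walls *)

Definition is_wall {X : Type} (W : set (set X)) : Prop :=
  exists A : set X, [/\ A !=set0, ~` A !=set0 & W = [set A; ~` A]].

(* Since [W] is closed under complement, one of its half-spaces contains [x] and
   not [y] as soon as [x] and [y] lie in different ones. *)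
Definition separates {X : Type} (W : set (set X)) (x y : X) : Prop :=
  exists A, [/\ W A, A x & ~ A y].

Record wallSpace : Type := WallSpace {
  wpoint :> Type;
  walls : set (set (set wpoint));
  walls_are_walls : forall W, walls W -> is_wall W;
  walls_separate : forall x y : wpoint, x <> y ->
    finite_set (walls `&` [set W | separates W x y]) /\
    (walls `&` [set W | separates W x y]) !=set0
}.

Section WallSpace.
Variable X : wallSpace.
Implicit Types (x y z : X) (W : set (set X)).

Definition separating x y : set (set (set X)) :=
  @walls X `&` [set W | separates W x y].

Definition half_space (A : set X) : Prop := exists2 W, @walls X W & W A.

Definition between x y z : Prop :=
  separating x y = separating x z `|` separating z y.

Definition edge x y : Prop :=
  x <> y /\ forall z, between x y z -> z = x \/ z = y.

Lemma separates_sym W x y : @walls X W -> separates W x y -> separates W y x.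
Proof.
move=> /walls_are_walls [A [_ _ ->]] [B [[->|->] Bx By]].
- by exists (~` A); split=> [|//|]; [right|move=> /(_ Bx)].
- by exists A; split=> //; [left|exact: contrapT].
Qed.

Lemma separating_sym x y : separating x y = separating y x.
Proof.
by apply/seteqP; split=> W [MW s]; split=> //; exact: separates_sym.
Qed.

Lemma separatingxx x : separating x x = set0.
Proof. by apply/seteqP; split=> // W [_ [A []]]. Qed.

Lemma between_disj x y z W :
  between x y z -> separating x z W -> separating z y W -> False.
Proof.
move=> b sxz szy; have : separating x y W by rewrite b; left.
case: sxz => MW [A [WA Ax Az]]; case: szy => _ [B [WB Bz By]] [_ [C [WC Cx Cy]]].
case: (walls_are_walls MW) => D [_ _ WE]; move: WA WB WC; rewrite WE.
by move: Az Ax Bz By Cx Cy => + + + + + + [] EA [] EB [] EC;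
  rewrite EA EB EC /setC /=; tauto.
Qed.

Lemma between_sym x y z : between x y z -> between y x z.
Proof.
by rewrite /between (separating_sym y x) (separating_sym y z)
  (separating_sym z x) setUC.
Qed.

Lemma edge_sym x y : edge x y -> edge y x.
Proof.
move=> [xy h]; split; first exact/nesym.
by move=> z /between_sym/h [->|->]; [right|left].
Qed.

(** *** The group of automorphisms *)

(* A wall [W] is mapped by [g] to the set of the images of its half-spaces. *)
Record wall_aut : Type := WallAut {
  aut_fun :> X -> X;
  aut_inv : X -> X;
  aut_funK : cancel aut_fun aut_inv;
  aut_invK : cancel aut_inv aut_fun;
  aut_walls : forall W, @walls X W <-> @walls X [set aut_fun @` A | A in W]
}.

Lemma wall_aut_eq (g h : wall_aut) : (forall x, g x = h x) -> g = h.
Proof.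
case: g h => [g g' gK g'K gW] [h h' hK h'K hW] /= gh.
have e : g = h by exact/funext.
subst h; have e' : g' = h' by apply/funext => x; rewrite -{1}(h'K x) gK.
by subst h'; congr WallAut; exact: Prop_irrelevance.
Qed.

Lemma image_wall_comp (f g : X -> X) W :
  [set f @` A | A in [set g @` A | A in W]] = [set (f \o g) @` A | A in W].
Proof.
apply/seteqP; split=> [_ [_ [A WA <-] <-]|_ [A WA <-]].
  by exists A => //; rewrite image_comp.
by exists (g @` A); [exists A|rewrite image_comp].
Qed.

Lemma image_wall_id W : [set id @` A | A in W] = W.
Proof.
apply/seteqP; split=> [_ [A WA <-]|A WA]; first by rewrite image_id.
by exists A; rewrite ?image_id.
Qed.

Definition aut_one : wall_aut.
Proof.
by refine (@WallAut id id (fun=> erefl) (fun=> erefl) _) => W;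
  rewrite image_wall_id.
Defined.

Definition aut_mul (g h : wall_aut) : wall_aut.
Proof.
refine (@WallAut (g \o h) (aut_inv h \o aut_inv g) _ _ _).
- exact: can_comp (aut_funK g) (aut_funK h).
- exact: can_comp (aut_invK h) (aut_invK g).
- by move=> W; rewrite -image_wall_comp -aut_walls -aut_walls.
Defined.

Definition aut_invg (g : wall_aut) : wall_aut.
Proof.
refine (@WallAut (aut_inv g) g (aut_invK g) (aut_funK g) _) => W.
rewrite (aut_walls g [set _ | _ in W]) image_wall_comp.
have -> : g \o aut_inv g = id by apply/funext => x /=; exact: aut_invK.
by rewrite image_wall_id.
Defined.

HB.instance Definition _ := gen_eqMixin wall_aut.
HB.instance Definition _ := gen_choiceMixin wall_aut.

Let aut_mulA : associative aut_mul.
Proof. by move=> f g h; exact: wall_aut_eq. Qed.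
Let aut_mul1 : left_id aut_one aut_mul.
Proof. by move=> f; exact: wall_aut_eq. Qed.
Let aut_mulr1 : right_id aut_one aut_mul.
Proof. by move=> f; exact: wall_aut_eq. Qed.
Let aut_mulV : left_inverse aut_one aut_invg aut_mul.
Proof. by move=> f; apply: wall_aut_eq => x /=; exact: aut_funK. Qed.
Let aut_mulrV : right_inverse aut_one aut_invg aut_mul.
Proof. by move=> f; apply: wall_aut_eq => x /=; exact: aut_invK. Qed.

HB.instance Definition _ := isGroup.Build wall_aut
  aut_mulA aut_mul1 aut_mulr1 aut_mulV aut_mulrV.

Lemma separating_aut (g : wall_aut) x y W :
  separating x y W <-> separating (g x) (g y) [set g @` A | A in W].
Proof.
split=> [[MW [A [WA Ax Ay]]]|[/(aut_walls g W).2 MW [_ [[A WA <-] Ax Ay]]]].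
  split; first exact: (aut_walls g W).1.
  exists (g @` A); split; [by exists A|by exists x|].
  by move=> [z Az /(can_inj (aut_funK g)) zy]; rewrite -zy in Ay.
split=> //; exists A; split=> [//||Ay']; last by apply: Ay; exists y.
by case: Ax => z Az /(can_inj (aut_funK g)) <-.
Qed.

Lemma between_aut (g : wall_aut) x y z :
  between (g x) (g y) (g z) -> between x y z.
Proof.
rewrite /between => b; apply/seteqP; split=> W.
  move=> /(separating_aut g x y W).1; rewrite b => -[] h.
    by left; exact: (separating_aut g x z W).2.
  by right; exact: (separating_aut g z y W).2.
move=> h; apply: (separating_aut g x y W).2; rewrite b.
case: h => h; first by left; exact: (separating_aut g x z W).1.
by right; exact: (separating_aut g z y W).1.
Qed.

Lemma edge_aut (g : wall_aut) x y : edge x y -> edge (g x) (g y).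
Proof.
move=> [xy h]; split; first by move=> e; exact: xy (can_inj (aut_funK g) e).
move=> z.
rewrite -(aut_invK g z) => /between_aut/h.
by case=> ->; [left|right].
Qed.

End WallSpace.

(** ** The associated metric graph *)

Section Graph.
Variables (R : realType) (X : wallSpace).
Implicit Types (x y z : X) (f : X -> R).

(* The points of the geometric realization are given by their barycentric
   coordinates with respect to the vertices. *)
Definition closed_edge x y f : Prop :=
  exists2 t, 0 <= t <= 1 &
    f = fun z => (1 - t) * \1_[set x] z + t * \1_[set y] z.

Definition graph : Type :=
  {f : X -> R | (exists x, f = \1_[set x]) \/
                (exists x y, edge x y /\ closed_edge x y f)}.

Implicit Types p q r : graph.

(* Each edge has length [1]: for [p] and [q] on a closed edge with endpoint [x],
   their distance along the edge is [`|sval p x - sval q x|].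
   [string_length p q l] means that [p] and [q] are joined by a string of points,
   consecutive ones lying on a common edge, of total length [l]. *)
Inductive string_length : graph -> graph -> R -> Prop :=
| string_nil p : string_length p p 0
| string_cons p q r x y l :
    edge x y -> closed_edge x y (sval p) -> closed_edge x y (sval q) ->
    string_length q r l ->
    string_length p r (`|sval p x - sval q x| + l).

Definition graph_dist p q : R := inf [set l | string_length p q l].

Lemma graph_eq p q : sval p = sval q -> p = q.
Proof.
by case: p q => [f hf] [f' hf'] /= ff'; subst f';
  congr exist; exact: Prop_irrelevance.
Qed.

Lemma string_edge p q x y : edge x y -> closed_edge x y (sval p) ->
  closed_edge x y (sval q) -> string_length p q `|sval p x - sval q x|.
Proof.
by move=> e hp hq; rewrite -[X in string_length _ _ X]addr0; apply: (string_cons e) hq _ => //;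
  exact: string_nil.
Qed.

Lemma string_cat p q r l m :
  string_length p q l -> string_length q r m -> string_length p r (l + m).
Proof.
elim=> [s|s q' r' x y k e hs hq _ IH] h; first by rewrite add0r.
by rewrite -addrA; apply: (string_cons e hs hq); exact: IH.
Qed.

Lemma string_sym p q l : string_length p q l -> string_length q p l.
Proof.
elim=> [s|s q' r x y k e hs hq _ IH]; first exact: string_nil.
rewrite addrC distrC; apply: string_cat IH _; exact: string_edge e hq hs.
Qed.

Lemma string_ge0 p q l : string_length p q l -> 0 <= l.
Proof. by elim=> // *; rewrite addr_ge0. Qed.

Lemma closed_edge_coord x y f f' z : edge x y -> closed_edge x y f ->
  closed_edge x y f' -> `|f z - f' z| <= `|f x - f' x|.
Proof.
move=> [xy _] [t _ ->] [t' _ ->]; rewrite !indicE.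
have yx : (x \in [set y]) = false by apply/negbTE/negP; rewrite inE.
rewrite yx (_ : x \in [set x]); last by rewrite inE.
rewrite !mulr1 !mulr0 !addr0.
have [->|zx] := pselect (z = x).
  by rewrite yx (_ : x \in [set x]) ?inE// !mulr1 !mulr0 !addr0.
have -> : (z \in [set x]) = false by apply/negbTE/negP; rewrite inE.
rewrite !mulr0 !add0r.
have [->|zy] := pselect (z = y).
  rewrite (_ : y \in [set y]) ?inE// !mulr1 opprB.
  by rewrite [1 - t + _]addrC addrA subrK distrC.
have -> : (z \in [set y]) = false by apply/negbTE/negP; rewrite inE.
by rewrite !mulr0 subrr normr0.
Qed.

Lemma string_coord p q l z : string_length p q l -> `|sval p z - sval q z| <= l.
Proof.
elim=> [s|s q' r x y k e hs hq _ IH]; first by rewrite subrr normr0.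
apply: (le_trans (ler_distD (sval q' z) _ _)).
by apply: lerD => //; exact: closed_edge_coord e hs hq.
Qed.

Let vertex_ax x : (exists y, \1_[set x] = \1_[set y] :> (X -> R)) \/
  (exists y z, edge y z /\ closed_edge y z (\1_[set x] : X -> R)).
Proof. by left; exists x. Qed.

Definition vertex x : graph := exist _ (\1_[set x]) (vertex_ax x).

Lemma closed_edge_left x y : closed_edge x y (\1_[set x]).
Proof.
exists 0; first by rewrite lexx ler01.
by apply/funext => z; rewrite subr0 mul1r mul0r addr0.
Qed.

Lemma closed_edge_right x y : closed_edge x y (\1_[set y]).
Proof.
exists 1; first by rewrite lexx ler01.
by apply/funext => z; rewrite subrr mul1r mul0r add0r.
Qed.

Lemma string_vertex x y : exists l, string_length (vertex x) (vertex y) l.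
Proof.
have [n] := ubnP #|` fset_set (separating x y)|%fset.
elim: n x y => // n IH x y.
have [->|xy] := pselect (x = y); first by exists 0; exact: string_nil.
have fin (a b : X) : finite_set (separating a b).
  have [->|ab] := pselect (a = b); first by rewrite separatingxx.
  exact: (walls_separate ab).1.
rewrite ltnS => cn.
have [e|ne] := pselect (edge x y).
  exists `|sval (vertex x) x - sval (vertex y) x|.
  by apply: (string_edge e); [exact: closed_edge_left|exact: closed_edge_right].
have [z [b zx zy]] : exists z, [/\ between x y z, z <> x & z <> y].
  apply: contrapT => h; apply: ne; split=> // z b.
  have [|zx] := pselect (z = x); first by left.
  have [|zy] := pselect (z = y); first by right.
  by exfalso; apply: h; exists z.
have lt A B : finite_set A -> finite_set B -> A `<` B ->
    (#|` fset_set A| < #|` fset_set B|)%N.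
  move=> fA fB [AB BA]; apply: fproper_ltn_card; rewrite fproperEneq.
  apply/andP; split; last by rewrite -fset_set_sub.
  by apply/eqP => /(congr1 (fun F => [set` F])); rewrite !fset_setK// => E;
    apply: BA; rewrite E.
have [l hl] : exists l, string_length (vertex x) (vertex z) l.
  apply: IH; apply: leq_trans cn; apply: lt => //.
  split; first by rewrite b => W; left.
  have [W hW] := (walls_separate zy).2.
  move=> h; apply: (between_disj b _ hW); apply: h.
  by rewrite b; right.
have [m hm] : exists m, string_length (vertex z) (vertex y) m.
  apply: IH; apply: leq_trans cn; apply: lt => //.
  split; first by rewrite b => W; right.
  have [W hW] := (walls_separate (nesym zx)).2.
  move=> h; apply: (between_disj b hW); apply: h.
  by rewrite b; left.
by exists (l + m); exact: string_cat hl hm.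
Qed.

Lemma string_exists p q : exists l, string_length p q l.
Proof.
have to_vertex r : exists x l, string_length r (vertex x) l.
  case: (svalP r) => [[x rx]|[x [y [e h]]]].
    exists x, 0; suff -> : r = vertex x by exact: string_nil.
    exact: graph_eq.
  exists x; eexists; apply: (string_edge e) => //; exact: closed_edge_left.
have [x [l pl]] := to_vertex p; have [y [m qm]] := to_vertex q.
have [n xy] := string_vertex x y.
by exists (l + (n + m)); apply: string_cat pl (string_cat xy (string_sym qm)).
Qed.

Let has_inf_string p q : has_inf [set l | string_length p q l].
Proof.
split; first exact: string_exists.
by exists 0 => l; exact: string_ge0.
Qed.

Lemma graph_dist_le p q l : string_length p q l -> graph_dist p q <= l.
Proof. by move=> h; apply: ge_inf => //; exact: (has_inf_string p q).2. Qed.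

Let graph_distxx p : graph_dist p p = 0.
Proof.
apply/eqP; rewrite eq_le graph_dist_le/=; last exact: string_nil.
by apply: lb_le_inf; [exact: string_exists|move=> l /string_ge0].
Qed.

Let graph_dist_positivity p q : graph_dist p q = 0 -> p = q.
Proof.
move=> d0; apply: graph_eq; apply/funext => z.
apply/eqP; rewrite -subr_eq0 -normr_le0 -d0.
by apply: lb_le_inf; [exact: string_exists|move=> l /(string_coord z)].
Qed.

Let graph_dist_sym p q : graph_dist p q = graph_dist q p.
Proof.
by congr inf; apply/seteqP; split=> l; exact: string_sym.
Qed.

Let graph_dist_triangle q p r :
  graph_dist p r <= graph_dist p q + graph_dist q r.
Proof.
rewrite -lerBlDr; apply: lb_le_inf; first exact: string_exists.
move=> l pq; rewrite lerBlDl -lerBlDr; apply: lb_le_inf.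
  exact: string_exists.
move=> m qr; rewrite lerBlDr addrC; apply: graph_dist_le.
exact: string_cat pq qr.
Qed.

HB.instance Definition _ := gen_eqMixin graph.
HB.instance Definition _ := gen_choiceMixin graph.
HB.instance Definition _ := isMetric.Build R graph graph_distxx
  graph_dist_positivity graph_dist_sym graph_dist_triangle.

(** *** The action of automorphisms *)

Lemma indic_aut (g : wall_aut X) x :
  \1_[set x] \o aut_inv g = \1_[set g x] :> (X -> R).
Proof.
apply/funext => z /=; rewrite !indicE; congr (nat_of_bool _)%:R.
apply/idP/idP; rewrite !inE /=.
  by move=> <-; rewrite aut_invK.
by move=> ->; rewrite aut_funK.
Qed.

Let graph_act_ax (g : wall_aut X) p :
  (exists x, sval p \o aut_inv g = \1_[set x]) \/
  (exists x y, edge x y /\ closed_edge x y (sval p \o aut_inv g)).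
Proof.
case: (svalP p) => [[x ->]|[x [y [e [t t01 ->]]]]].
  by left; exists (g x); exact: indic_aut.
right; exists (g x), (g y); split; first exact: edge_aut.
by exists t => //; rewrite -!indic_aut.
Qed.

(* [g] is extended affinely to the edges: the coordinate of the image of [p] at
   [g x] is the coordinate of [p] at [x]. *)
Definition graph_act (g : wall_aut X) p : graph :=
  exist _ (sval p \o aut_inv g) (graph_act_ax g p).

(* A half-space is viewed as the full subgraph with this set of vertices. *)
Definition full_subgraph (A : set X) : set graph :=
  [set p | forall x, sval p x != 0 -> A x].

(* The closure of a half-space in the union of the graph and its boundary. *)
Definition closure_at_infinity (A : set X) : set (bordification graph) :=
  closure (@Inner R graph @` full_subgraph A).

Definition hyperbolic_wallSpace : Prop :=
  gromov_hyperbolic graph /\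
  forall (xi : boundary graph) (U : set (bordification graph)),
    nbhs (Ideal xi) U ->
    exists A : set X, [/\ half_space A, (closure_at_infinity A)^° (Ideal xi) &
      closure_at_infinity A `<=` U].

Definition proper_wall (W : set (set X)) : Prop :=
  forall A, W A -> @Ideal R graph @^-1` closure_at_infinity A <> setT.

End Graph.

(** ** Strict fixators and property (P) *)

Section Fixators.
Variable X : wallSpace.
Implicit Types (W : set (set X)) (A : set X) (G : set (wall_aut X)).

Definition strictly_fixes (g : wall_aut X) W : Prop :=
  forall x y, edge x y -> separates W x y -> g x = x /\ g y = y.

Definition strict_fixator G W : set (wall_aut X) :=
  [set g | G g /\ strictly_fixes g W].

Definition chain (A : int -> set X) : Prop :=
  forall i, half_space (A i) /\ A (i + 1) `<` A i.

Definition chain_fixator G (A : int -> set X) : set (wall_aut X) :=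
  [set g | G g /\ forall i, strictly_fixes g [set A i; ~` A i]].

(* The groups [G_A], [G_(X \ A)] and [G_(C, i)] consist of the restrictions of
   elements of [G_M] and [G_C]; surjectivity of the restriction morphisms is
   therefore the possibility of gluing such restrictions. *)
Definition property_P G : Prop :=
  (forall A, half_space A -> forall g h,
     strict_fixator G [set A; ~` A] g -> strict_fixator G [set A; ~` A] h ->
     exists k, [/\ strict_fixator G [set A; ~` A] k,
       forall x, A x -> k x = g x & forall x, ~ A x -> k x = h x]) /\
  (forall A : int -> set X, chain A -> forall g : int -> wall_aut X,
     (forall i, chain_fixator G A (g i)) ->
     exists k, chain_fixator G A k /\
       forall i x, (A i `\` A (i + 1)) x -> k x = g i x).

Definition Gplus (R : realType) G : set (wall_aut X) :=
  generated (\bigcup_(W in [set W | @walls X W /\ proper_wall R W])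
               strict_fixator G W).

End Fixators.

(* Main.v *)
Require Import Defs.
From mathcomp Require Import all_boot all_order all_algebra finmap.
From mathcomp Require Import all_classical all_reals all_analysis.
From mathcomp Require Import lra zify.

Set Implicit Arguments.
Unset Strict Implicit.
Unset Printing Implicit Defensive.

Import Order.TTheory GRing.Theory Num.Theory.

Local Open Scope classical_set_scope.
Local Open Scope ring_scope.

(** Call a half-space ideal when its closure contains an ideal point in its
    interior; by hyperbolicity of the space with walls, ideal half-spaces form
    neighbourhood bases at infinity.  Say that a set [N] of automorphisms
    compresses when any two ideal half-spaces [V] and [W] admit [g] in [N]
    mapping the complement of [V] into [W].

    The group [G] compresses ([non_elementary_compresses]): some power of a
    hyperbolic isometry has north-south dynamics ([north_south]), fixed points
    of hyperbolic elements are dense at infinity, and two such dynamics can be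
    composed because [G] fixes no ideal point.

    Compression passes to normal subgroups moving an ideal point
    ([compresses_normalised]): if [k] maps [V] into a disjoint [W] and [g] maps
    the complement of [V] into [V], then the commutator [k g k^-1 g^-1] maps the
    complement of [V] into [W].  Assume that [H] acts non-trivially at infinity.
    Applied to [G^+] in [G] and then to [H] in [G^+], this shows that [H]
    compresses.

    Let [A] be a half-space of a proper wall, and [g] an element strictly fixing
    this wall and supported in [A].  Two disjoint ideal half-spaces [V] and [W]
    lie off [A], and some [h] in [H] maps the complement of [V], hence both [A]
    and [W], into [W].  The translates [h^i W] form a chain; [A] is contained in
    those with [i < 0] and disjoint from the others, so [g] strictly fixes all
    their walls.  By property (P) and the argument of Tits, [g] is a commutator
    [f h f^-1 h^-1] with [f] strictly fixing the chain, in particular [f] in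
    [G^+], and so [g] is in [H] ([supported_in_normal]).  Property (P) also writes
    any element strictly fixing a proper wall as a product of two elements, one
    supported in each half-space; hence [H] contains the generators of [G^+]. *)

(** * Gromov products and the boundary *)

Lemma near_pairP (P : nat -> nat -> Prop) :
  (\forall i \near \oo & j \near \oo, P i j) <->
  exists N, forall i j, (N <= i)%N -> (N <= j)%N -> P i j.
Proof.
split=> [[[A B] [/= [m _ mA] [n _ nB]] AB]|[N NP]].
  exists (maxn m n) => i j; rewrite !geq_max => /andP[mi _] /andP[_ nj].
  by apply: (AB (i, j)); split; [exact: mA|exact: nB].
exists ([set i | (N <= i)%N], [set j | (N <= j)%N]) => /=.
  by split; exists N.
by move=> [i j] [/= Ni Nj]; exact: NP.
Qed.

Section GromovProduct.
Context {R : realType} {Y : metricType R}.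
Implicit Types (o x y z : Y).

Local Notation gp := (@gromov_product R Y).

Lemma gromov_productC o x y : gp o x y = gp o y x.
Proof. by rewrite /gromov_product (metric_sym x y) (addrC (mdist o x)). Qed.

Lemma gromov_product_ge0 o x y : 0 <= gp o x y.
Proof.
by have := metric_triangle x o y; rewrite (metric_sym x o) /gromov_product; lra.
Qed.

Lemma gromov_product_lel o x y : gp o x y <= mdist o x.
Proof. by have := metric_triangle o x y; rewrite /gromov_product; lra. Qed.

Lemma gromov_product_base o o' x y : gp o' x y - mdist o o' <= gp o x y.
Proof.
have := metric_triangle o' o x; have := metric_triangle o' o y.
by rewrite (metric_sym o' o) /gromov_product; lra.
Qed.

Lemma gromov_product_lipschitz o x y z : gp o x y - mdist y z <= gp o x z.
Proof.
have := metric_triangle o z y; have := metric_triangle x y z.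
by rewrite /gromov_product (metric_sym z y); lra.
Qed.

Lemma product_to_infinityP (u v : nat -> Y) : product_to_infinity u v <->
  forall o A, exists N, forall i j, (N <= i)%N -> (N <= j)%N ->
    A <= gp o (u i) (v j).
Proof.
split=> h o.
  move=> A; have /cvgryPge/(_ A) := h o.
  by move/(near_pairP (fun i j => A <= gp o (u i) (v j))).
apply/cvgryPge => A.
by apply/(near_pairP (fun i j => A <= gp o (u i) (v j))); exact: h.
Qed.

(** Gromov products at two base points differ by at most the distance between
    them, so one base point suffices. *)
Lemma product_to_infinity1 (o : Y) (u v : nat -> Y) :
  (forall A, exists N, forall i j, (N <= i)%N -> (N <= j)%N ->
    A <= gp o (u i) (v j)) -> product_to_infinity u v.
Proof.
move=> h; apply/product_to_infinityP => o' A.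
have [N hN] := h (A + mdist o' o); exists N => i j Ni Nj.
have := hN i j Ni Nj; have := gromov_product_base o' o (u i) (v j); lra.
Qed.

Lemma product_to_infinity_sym (u v : nat -> Y) :
  product_to_infinity u v -> product_to_infinity v u.
Proof.
move=> /product_to_infinityP h; apply/product_to_infinityP => o A.
by have [N hN] := h o A; exists N => i j Ni Nj; rewrite gromov_productC hN.
Qed.

Lemma product_geP o (z w : bordification Y) r : product_ge o z w r <->
  exists u v, [/\ represents u z, represents v w & forall s, s < r ->
    exists N, forall i j, (N <= i)%N -> (N <= j)%N -> s <= gp o (u i) (v j)].
Proof.
split=> -[u [v [uz vw h]]]; exists u, v; split=> // s /h.
  by move/(near_pairP (fun i j => s <= gp o (u i) (v j))).
by move=> ?; apply/(near_pairP (fun i j => s <= gp o (u i) (v j))).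
Qed.

Lemma product_ge_sym o (z w : bordification Y) r :
  product_ge o z w r -> product_ge o w z r.
Proof.
move=> /product_geP[u [v [uz vw h]]]; apply/product_geP; exists v, u; split=> //.
by move=> s /h[N hN]; exists N => i j Ni Nj; rewrite gromov_productC hN.
Qed.

Lemma boundary_mem (xi : boundary Y) : exists u, sval xi u.
Proof. by case: (svalP xi) => u cu ->; exists u; split. Qed.

Lemma boundary_converges (xi : boundary Y) u :
  sval xi u -> converges_at_infinity u.
Proof. by case: (svalP xi) => u0 cu0 -> []. Qed.

Definition ideal_of (u : nat -> Y) (cu : converges_at_infinity u) : boundary Y :=
  exist _ (boundary_class u) (ex_intro2 _ _ u cu erefl).

Lemma ideal_of_mem u (cu : converges_at_infinity u) : sval (ideal_of cu) u.
Proof. by split. Qed.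

Lemma boundary_inj (xi eta : boundary Y) : sval xi = sval eta -> xi = eta.
Proof.
case: xi eta => [A hA] [B hB] /= AB; subst B; congr exist; exact: Prop_irrelevance.
Qed.

End GromovProduct.

Section GromovHyperbolic.
Context {R : realType} {Y : metricType R}.
Local Notation gp := (@gromov_product R Y).
Variable delta : R.
Hypothesis hypY : forall o x y z : Y,
  Num.min (gp o x y) (gp o y z) - delta <= gp o x z.
Implicit Types (o x y z : Y) (xi eta : boundary Y).

Lemma hyperbolic_ge o x y z s :
  s <= gp o x y -> s <= gp o y z -> s - delta <= gp o x z.
Proof.
move=> h1 h2; apply: le_trans (hypY o x y z); rewrite lerD2r.
by rewrite le_min h1.
Qed.

Lemma delta_ge0 : Y -> 0 <= delta.
Proof.
move=> y; have := hypY y y y y.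
by rewrite minxx gerBl.
Qed.

Lemma four_point o x y z : mdist o y + mdist x z <=
  Num.max (mdist o x + mdist y z) (mdist o z + mdist x y) + 2 * delta.
Proof.
have := hypY o x y z; rewrite -lerBlDr le_max.
by case: (leP (gp o x y) (gp o y z)) => _; rewrite /gromov_product => h;
  apply/orP; [right|left]; lra.
Qed.

Lemma product_to_infinity_trans (u v w : nat -> Y) :
  product_to_infinity u v -> product_to_infinity v w -> product_to_infinity u w.
Proof.
move=> /product_to_infinityP uv /product_to_infinityP vw.
apply/product_to_infinityP => o A.
have [M hM] := uv o (A + delta); have [N hN] := vw o (A + delta).
exists (maxn M N) => i j; rewrite !geq_max => /andP[Mi Ni] /andP[Mj Nj].
rewrite -(addrK delta A).
by apply: (@hyperbolic_ge _ _ (v (maxn M N))); [apply: hM|apply: hN];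
  rewrite ?leq_maxl ?leq_maxr.
Qed.

Lemma boundaryP xi u v : sval xi u ->
  sval xi v <-> converges_at_infinity v /\ product_to_infinity u v.
Proof.
case: (svalP xi) => u0 cu0 -> [cu u0u]; split=> -[cv uv]; split=> //.
  exact: product_to_infinity_trans (product_to_infinity_sym u0u) uv.
exact: product_to_infinity_trans u0u uv.
Qed.

Lemma boundary_eq xi eta u v : sval xi u -> sval eta v ->
  product_to_infinity u v -> xi = eta.
Proof.
move=> xu ev uv; apply: boundary_inj; apply/seteqP; split=> w.
  move=> /(boundaryP _ xu)[cw uw]; apply/(boundaryP _ ev); split=> //.
  by apply: product_to_infinity_trans uw; exact: product_to_infinity_sym.
move=> /(boundaryP _ ev)[cw vw]; apply/(boundaryP _ xu); split=> //.
exact: product_to_infinity_trans vw.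
Qed.

(** The ultrametric inequality at infinity.  The middle point may have two
    different representatives: if it is ideal, their products tend to infinity;
    if it is inner, both are the same constant sequence, whose product with itself
    is the distance to [o], which bounds the other products from above. *)
Lemma product_ge_trans o (z w t : bordification Y) r :
  product_ge o z w r -> product_ge o w t r -> product_ge o z t (r - 2 * delta).
Proof.
move=> /product_geP[u [v [uz vw uv]]] /product_geP[v' [t' [v'w t't v't]]].
have d0 := delta_ge0 (v 0).
apply/product_geP; exists u, t'; split=> // s sr.
have [M hM] := uv (s + 2 * delta) ltac:(lra).
have [N hN] := v't (s + 2 * delta) ltac:(lra).
have [K hK] : exists K, forall i j, (K <= i)%N -> (K <= j)%N ->
    s + 2 * delta <= gp o (v i) (v' j).
  case: w vw v'w => [y /= vy v'y|xi xv xv'].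
    exists M => i j Mi _; have := hM i i Mi Mi; subst v v'.
    have := gromov_product_lel o y (u i); rewrite gromov_productC.
    by rewrite {3}/gromov_product mdistxx; lra.
  by have /product_to_infinityP := ((boundaryP v' xv).1 xv').2.
pose L := maxn K (maxn M N).
exists L => i j; rewrite !geq_max => /and3P[Ki Mi Ni] /and3P[Kj Mj Nj].
have LK : (K <= L)%N by rewrite leq_maxl.
have LM : (M <= L)%N by rewrite /L leq_max leq_maxl orbT.
have LN : (N <= L)%N by rewrite /L leq_max leq_maxr orbT.
have -> : s = s + 2 * delta - delta - delta by lra.
apply: (@hyperbolic_ge _ _ (v' L)).
  by apply: (@hyperbolic_ge _ _ (v L)); [exact: hM|exact: hK].
by apply: le_trans (hN L j LN Nj); lra.
Qed.

Lemma product_ge_boundary_eq o xi eta :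
  (forall r, product_ge o (Ideal xi) (Ideal eta) r) -> xi = eta.
Proof.
move=> h; have [u xu] := boundary_mem xi; have [v ev] := boundary_mem eta.
apply: (boundary_eq xu ev); apply: (product_to_infinity1 (o := o)) => A.
have /product_geP[u' [v' [/= xu' ev' h']]] := h (A + 2 * delta + 1).
have [K hK] := h' (A + 2 * delta) ltac:(lra).
have /product_to_infinityP/(_ o (A + 2 * delta))[M hM] :=
  ((boundaryP u' xu).1 xu').2.
have /product_to_infinityP/(_ o (A + 2 * delta))[N hN] :=
  ((boundaryP v ev').1 ev).2.
have d0 := delta_ge0 o.
pose L := maxn K (maxn M N).
exists L => i j; rewrite !geq_max => /and3P[Ki Mi Ni] /and3P[Kj Mj Nj].
have LK : (K <= L)%N by rewrite leq_maxl.
have LM : (M <= L)%N by rewrite /L leq_max leq_maxl orbT.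
have LN : (N <= L)%N by rewrite /L leq_max leq_maxr orbT.
have -> : A = A + 2 * delta - delta - delta by lra.
apply: (@hyperbolic_ge _ _ (v' L)).
  by apply: (@hyperbolic_ge _ _ (u' L)); [exact: hM|exact: hK].
by apply: le_trans (hN L j LN Nj); lra.
Qed.

Lemma product_ge_refl o xi r : product_ge o (Ideal xi) (Ideal xi) r.
Proof.
have [u xu] := boundary_mem xi; apply/product_geP; exists u, u; split=> // s _.
by have /product_to_infinityP := boundary_converges xu; apply.
Qed.

(** The sets [product_ge o (Ideal xi) _ r] generate the topology but need not be
    open; they are nevertheless neighbourhoods of [xi].  The open set consists of
    the inner points with product larger than [r] and of the ideal points having a
    whole basic set of such points around them; it is open because basic sets
    around nearby ideal points are nested, up to [2 * delta]. *)
Lemma ideal_nbhs o xi r : exists U : set (bordification Y),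
  [/\ open U, U (Ideal xi) & U `<=` [set z | product_ge o (Ideal xi) z r]].
Proof.
pose S (eta : boundary Y) t := [set z | product_ge o (Ideal eta) z t].
have d0 := delta_ge0 o.
have sub eta zeta t : S eta (t + 2 * delta) (Ideal zeta) ->
    S zeta (t + 2 * delta) `<=` S eta t.
  move=> ez z zz; have := product_ge_trans ez zz.
  by apply: product_geW; lra.
pose big := [set z | exists2 r', r < r' & S xi r' z].
pose U (z : bordification Y) := match z with
  | Inner y => big (Inner y)
  | Ideal eta => exists t, S eta t `<=` big
  end.
exists U; split; last first.
- have bigS : big `<=` S xi r by move=> z [r' rr']; apply: product_geW; lra.
  case=> [y /bigS//|eta [t /= h]]; apply: bigS; apply: h; exact: product_ge_refl.
- by exists (r + 1) => z hz; exists (r + 1); rewrite ?ltrDl.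
split=> [y [r' rr' /product_geP[u [v [xu /= vy h]]]]|eta [t h] o'].
  have e0 : 0 < (r' - r) / 2 by rewrite divr_gt0 ?subr_gt0.
  have : nbhs y (ball y ((r' - r) / 2)) by exact: nbhsx_ballx.
  rewrite ballEmdist; apply: filterS => y' /= yy'.
  exists ((r + r') / 2); first by lra.
  apply/product_geP; exists u, (fun=> y'); split=> // s sr.
  have [N hN] := h (s + (r' - r) / 2) ltac:(lra).
  exists N => i j Ni Nj; have := hN i j Ni Nj; subst v => /=.
  by have := gromov_product_lipschitz o (u i) y y'; lra.
exists (t + 2 * delta + mdist o o') => z hz.
have {}hz : S eta (t + 2 * delta) z.
  move/product_geP: hz => [u [v [eu vz k]]]; apply/product_geP; exists u, v.
  split=> // s sr; have [N hN] := k (s + mdist o o') ltac:(lra).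
  exists N => i j Ni Nj; have := hN i j Ni Nj.
  by have := gromov_product_base o o' (u i) (v j); lra.
case: z hz => [y hz|zeta hz]; first by apply: h; apply: product_geW hz; lra.
by exists (t + 2 * delta) => z /(sub _ _ _ hz) /h.
Qed.

(** If the basic sets of every radius around [xi] and [eta] met, then the product
    of [xi] and [eta] would be infinite. *)
Lemma ideal_hausdorff xi eta : xi <> eta -> exists U V : set (bordification Y),
  [/\ open U, open V, U (Ideal xi), V (Ideal eta) & U `&` V = set0].
Proof.
move=> xe; have [u _] := boundary_mem xi; pose o := u 0.
have [r hr] : exists r, ~ product_ge o (Ideal xi) (Ideal eta) r.
  by apply/not_existsP => h; apply: xe; apply: (@product_ge_boundary_eq o) => r;
    exact: contrapT.
have [U [oU Ux US]] := ideal_nbhs o xi (r + 2 * delta).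
have [V [oV Ve VS]] := ideal_nbhs o eta (r + 2 * delta).
exists U, V; split=> //; apply/seteqP; split=> // z [/US /= xz /VS /= ez].
apply: hr; have := product_ge_trans xz (product_ge_sym ez).
by rewrite addrK.
Qed.

End GromovHyperbolic.

(** * Extension of isometries to the boundary *)

Section IsometricAction.
Context {R : realType} {Y : metricType R} {gT : groupType}.
Variable act : gT -> Y -> Y.
Hypothesis act1 : forall y, act 1%g y = y.
Hypothesis actM : forall g h y, act (g * h)%g y = act g (act h y).
Hypothesis act_isom : forall g x y, mdist (act g x) (act g y) = mdist x y.
Implicit Types (g h : gT) (o x y : Y) (xi eta : boundary Y).
Local Notation gp := (@gromov_product R Y).

Lemma actKV g y : act g (act g^-1%g y) = y.
Proof. by rewrite -actM mulgV act1. Qed.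

Lemma gromov_product_act g o x y : gp (act g o) (act g x) (act g y) = gp o x y.
Proof. by rewrite /gromov_product !act_isom. Qed.

Definition act_seq g (u : nat -> Y) : nat -> Y := fun n => act g (u n).

Lemma product_to_infinity_act g u v :
  product_to_infinity (act_seq g u) (act_seq g v) <-> product_to_infinity u v.
Proof.
split=> /product_to_infinityP h; apply/product_to_infinityP => o A.
  have [N hN] := h (act g o) A; exists N => i j Ni Nj.
  by rewrite -(gromov_product_act g) hN.
have [N hN] := h (act g^-1%g o) A; exists N => i j Ni Nj.
by rewrite -(actKV g o) gromov_product_act hN.
Qed.

Lemma act_ideal_subproof g xi : exists2 u, converges_at_infinity u &
  [set act_seq g u | u in sval xi] = boundary_class u.
Proof.
case: xi => C /= [u cu ->]; exists (act_seq g u).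
  exact/product_to_infinity_act.
apply/seteqP; split=> [_ [v [cv uv] <-]|v [cv uv]].
  by split; exact/product_to_infinity_act.
have e : act_seq g (act_seq g^-1%g v) = v.
  by apply/funext => n; rewrite /act_seq actKV.
by exists (act_seq g^-1%g v) => //; split; apply/(product_to_infinity_act g);
  rewrite e.
Qed.

Definition act_ideal g xi : boundary Y := exist _ _ (act_ideal_subproof g xi).

Lemma fixes_idealE g xi : fixes_ideal act g xi <-> act_ideal g xi = xi.
Proof. by split=> [h|h]; [exact: boundary_inj|exact: (congr1 sval h)]. Qed.

Definition act_bord g (z : bordification Y) : bordification Y :=
  match z with Inner y => Inner (act g y) | Ideal xi => Ideal (act_ideal g xi) end.

Lemma act_bordM g h z : act_bord (g * h)%g z = act_bord g (act_bord h z).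
Proof.
case: z => [y|xi] /=; first by rewrite actM.
congr Ideal; apply: boundary_inj => /=.
have e u : act_seq (g * h)%g u = act_seq g (act_seq h u).
  by apply/funext => n; rewrite /act_seq actM.
apply/seteqP; split=> [_ [u xu <-]|_ [_ [u xu <-] <-]].
  by rewrite e; exists (act_seq h u) => //; exists u.
by exists u.
Qed.

Lemma act_bord1 z : act_bord 1%g z = z.
Proof.
case: z => [y|xi] /=; first by rewrite act1.
congr Ideal; apply: boundary_inj => /=.
have e u : act_seq 1%g u = u by apply/funext => n; rewrite /act_seq act1.
apply/seteqP; split=> [_ [u xu <-]|u xu]; first by rewrite e.
by exists u.
Qed.

Lemma act_bordK g z : act_bord g^-1%g (act_bord g z) = z.
Proof. by rewrite -act_bordM mulVg act_bord1. Qed.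

Lemma act_bordKV g z : act_bord g (act_bord g^-1%g z) = z.
Proof. by rewrite -act_bordM mulgV act_bord1. Qed.

Lemma represents_act g u z :
  represents u z -> represents (act_seq g u) (act_bord g z).
Proof. by case: z => [y /= ->|xi /= xu] //; exists u. Qed.

Lemma product_ge_act g o z w r : product_ge o z w r ->
  product_ge (act g o) (act_bord g z) (act_bord g w) r.
Proof.
move=> [u [v [uz vw h]]]; exists (act_seq g u), (act_seq g v).
split; [exact: represents_act|exact: represents_act|move=> s /h].
by apply: filterS => -[i j] /=; rewrite gromov_product_act.
Qed.

Lemma act_bord_open g (U : set (bordification Y)) :
  open U -> open (act_bord g @^-1` U).
Proof.
move=> [U1 U2]; split=> [y /U1|xi /U2 h o].
  move=> /nbhs_ballP[e /= e0 he]; apply/nbhs_ballP; exists e => //= y'.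
  rewrite ballEmdist /= => yy'; apply: (he (act g y')).
  by rewrite ballEmdist /= act_isom.
have [r hr] := h (act g o); exists r => z /(product_ge_act g) /=; exact: hr.
Qed.

End IsometricAction.

(** * North-south dynamics *)

Section NorthSouth.
Context {R : realType} {Y : metricType R} {gT : groupType}.
Variable act : gT -> Y -> Y.
Hypothesis act1 : forall y, act 1%g y = y.
Hypothesis actM : forall g h y, act (g * h)%g y = act g (act h y).
Hypothesis act_isom : forall g x y, mdist (act g x) (act g y) = mdist x y.
Variable delta : R.
Local Notation gp := (@gromov_product R Y).
Hypothesis hypY : forall o x y z : Y,
  Num.min (gp o x y) (gp o y z) - delta <= gp o x z.
Implicit Types (g h : gT) (o x y : Y) (xi eta : boundary Y).
Local Notation ext := (act_bord act1 actM act_isom).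

Definition orbit g o : nat -> Y := fun n => act (g ^+ n)%g o.

Definition displacement g o (n : nat) : R := mdist o (orbit g o n).

Lemma orbit0 g o : orbit g o 0 = o.
Proof. by rewrite /orbit expg0 act1. Qed.

Lemma orbit_dist g o m n :
  mdist (orbit g o m) (orbit g o (m + n)) = displacement g o n.
Proof. by rewrite /displacement /orbit expgnDr actM act_isom. Qed.

Lemma displacement0 g o : displacement g o 0 = 0.
Proof. by rewrite /displacement orbit0 mdistxx. Qed.

Lemma displacementV g o n : displacement g^-1%g o n = displacement g o n.
Proof.
rewrite /displacement /orbit expVgn -(act_isom (g ^+ n)%g o) -actM mulgV act1.
exact: metric_sym.
Qed.

Lemma displacementD g o m n :
  displacement g o (m + n) <= displacement g o m + displacement g o n.
Proof. by rewrite -(orbit_dist g o m n); exact: metric_triangle. Qed.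

(** A gain of more than [3 * delta] between the first two displacements is what
    makes the orbit of [o] a quasi-geodesic, by local-to-global induction with the
    four-point inequality. *)
Definition drifts g o : Prop :=
  displacement g o 1 + 3 * delta + 1 <= displacement g o 2.

Lemma driftsV g o : drifts g o -> drifts g^-1%g o.
Proof. by rewrite /drifts !displacementV. Qed.

Section Drift.
Variables (g : gT) (o : Y).
Hypothesis go : drifts g o.
Local Notation a := (displacement g o).
Local Notation L := (a 1%N + 2 * delta).

(** Four-point inequality for the orbit points of indices [0], [n], [n + 1] and
    [n + 2]: of the two upper bounds for [a (n + 1) + a 2], the one by
    [a n + a 1] contradicts the induction hypothesis, because [g] drifts. *)
Lemma displacementS n : a n + 1 + delta <= a n.+1.
Proof.
have d0 := delta_ge0 hypY o; have := displacementD g o 1 1.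
rewrite addn1; move: go; rewrite /drifts => h1 h2.
elim: n => [|n IH]; first by rewrite displacement0; lra.
have := four_point hypY o (orbit g o n) (orbit g o n.+1) (orbit g o n.+2).
have -> : mdist (orbit g o n) (orbit g o n.+2) = a 2 by rewrite -addn2 orbit_dist.
have -> : mdist (orbit g o n) (orbit g o n.+1) = a 1 by rewrite -addn1 orbit_dist.
have -> : mdist (orbit g o n.+1) (orbit g o n.+2) = a 1.
  by rewrite -(addn1 n.+1) orbit_dist.
by rewrite -!/(displacement _ _ _) -lerBlDr le_max => /orP[] h; lra.
Qed.

(** Four-point inequality for the orbit points of indices [0], [p], [p + 1] and
    [p + q]; one of its two alternatives contradicts the growth of the
    displacement.  Geometrically, Gromov products of orbit points seen from an
    intermediate orbit point are bounded. *)
Lemma displacement_superadditive p q : a p + a q <= a (p + q) + L.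
Proof.
have d0 := delta_ge0 hypY o.
have a1 : 0 <= a 1%N by exact: mdist_ge0.
case: q => [|q]; first by rewrite addn0 displacement0; lra.
have := four_point hypY o (orbit g o p) (orbit g o p.+1) (orbit g o (p + q.+1)).
rewrite orbit_dist.
have -> : mdist (orbit g o p) (orbit g o p.+1) = a 1 by rewrite -addn1 orbit_dist.
have -> : mdist (orbit g o p.+1) (orbit g o (p + q.+1)) = a q.
  by rewrite addnS -addSn orbit_dist.
have := displacementS p; have := displacementS q.
by rewrite -!/(displacement _ _ _) -lerBlDr le_max => + + /orP[] h; lra.
Qed.

Lemma displacement_ge n : n%:R <= a n.
Proof.
have d0 := delta_ge0 hypY o.
elim: n => [|n IH]; first by rewrite displacement0.
by have := displacementS n; rewrite -natr1; lra.
Qed.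

Lemma displacement_homo m n : (m <= n)%N -> a m <= a n.
Proof.
have d0 := delta_ge0 hypY o.
move=> /subnKC <-; elim: (n - m)%N => [|k IH]; first by rewrite addn0.
by have := displacementS (m + k); rewrite addnS; lra.
Qed.

Lemma orbit_product k m n : (k <= m)%N -> (k <= n)%N ->
  a k - L <= gp o (orbit g o m) (orbit g o n).
Proof.
have d0 := delta_ge0 hypY o.
have a1 : 0 <= a 1%N by exact: mdist_ge0.
wlog mn : m n / (m <= n)%N.
  move=> W km kn; have [mn|/ltnW nm] := leqP m n; first exact: W.
  by rewrite gromov_productC; exact: W.
move=> km _; rewrite /gromov_product.
have -> : mdist (orbit g o m) (orbit g o n) = a (n - m).
  by rewrite -(orbit_dist g o m) subnKC.
rewrite -!/(displacement _ _ _).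
have := displacement_superadditive m (n - m); rewrite subnKC//.
by have := displacement_homo km; lra.
Qed.

Lemma orbit_converges : converges_at_infinity (orbit g o).
Proof.
apply: (product_to_infinity1 (o := o)) => A.
pose N := Num.bound (`|A| + L).
exists N => i j Ni Nj; apply: le_trans (orbit_product Ni Nj).
rewrite lerBrDr; apply: le_trans (displacement_ge N).
have d0 := delta_ge0 hypY o.
have a1 : 0 <= a 1%N by exact: mdist_ge0.
apply: le_trans (ltW (archi_boundP _)); first by rewrite lerD2r ler_norm.
by rewrite addr_ge0// addr_ge0// mulr_ge0.
Qed.

Definition attracting : boundary Y := ideal_of orbit_converges.

(** Seen from [x_k = g^k o], the image [g^k y] has small product with the far
    backward point [g^(k - i) o], whereas [o] has a large one; so [g^k y] has small
    product with [o].  Changing the base point to [o], this is a large product of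
    [g^k y] with [x_k], hence with the forward orbit. *)
Lemma north_south_inner i j k y r : (k <= i)%N -> (k <= j)%N ->
  r + L + delta <= a k -> gp o (orbit g^-1%g o i) y < r ->
  a k - r - L - 2 * delta <= gp o (orbit g o j) (act (g ^+ k)%g y).
Proof.
have d0 := delta_ge0 hypY o.
have a1 : 0 <= a 1%N by exact: mdist_ge0.
move=> ki kj rk; rewrite -(gromov_product_act act_isom (g ^+ k)%g) => h.
have r0 := le_lt_trans (gromov_product_ge0 _ _ _) h.
set y' := act _ y in h *; set xk := orbit g o k.
have e1 : act (g ^+ k)%g o = xk by [].
set xi := act _ (orbit _ _ _) in h.
have dk : mdist xk xi = a i by rewrite act_isom -displacementV.
have do' : mdist xi o = a (i - k)%N.
  rewrite -displacementV /displacement -(act_isom (g ^+ k)%g^-1%g xi).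
  rewrite metric_sym -actM mulVg act1 /orbit -(subnKC ki) expgnDr -expVgn actM.
  by rewrite act_isom addKn.
have h1 : a k - L <= gp xk xi o.
  rewrite /gromov_product dk do' (metric_sym xk) -/(a k).
  have := displacement_superadditive k (i - k); rewrite subnKC// .
  by have := displacement_homo (leq_subr k i); have := displacement_homo ki; lra.
have h2 : gp xk o y' < r + delta.
  rewrite ltNge; apply/negP => h3; rewrite e1 in h.
  have := hyperbolic_ge hypY (s := r + delta) _ h3.
  by move=> /(_ xi ltac:(lra)); rewrite addrK leNgt h.
have h3 : a k - r - delta <= gp o xk y'.
  have e : gp o xk y' = a k - gp xk o y'.
    by rewrite /gromov_product (metric_sym xk o) /displacement -/xk; lra.
  by rewrite e; lra.
have h4 : a k - L <= gp o (orbit g o j) xk by exact: orbit_product.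
by apply: le_trans (hyperbolic_ge hypY (s := a k - r - L - delta) (y := xk) _ _);
  lra.
Qed.

End Drift.

(** Only the representatives of the fixed points by orbits are needed: failing to
    have product at least [r] with the repelling point gives, arbitrarily far,
    terms of a representative of [z] to which the estimate for inner points
    applies; the other terms are close to these. *)
Lemma north_south_ge g o (go : drifts g o) r s : exists k, forall z,
  ~ product_ge o (Ideal (attracting (driftsV go))) z r ->
  product_ge o (Ideal (attracting go)) (ext (g ^+ k)%g z) s.
Proof.
have d0 := delta_ge0 hypY o.
pose L := displacement g o 1 + 2 * delta.
have a1 : 0 <= displacement g o 1 by exact: mdist_ge0.
pose M := `|s| + `|r| + L + 3 * delta.
have M0 : 0 <= M by rewrite /M /L; have := normr_ge0 s; have := normr_ge0 r; lra.
pose k := Num.bound M; exists k => z nz.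
have ak : M <= displacement g o k.
  by apply: le_trans (displacement_ge go k); exact: ltW (archi_boundP _).
have [v zv] : exists v, represents v z.
  by case: (z) => [y|xi]; [exists (fun=> y)|exact: boundary_mem].
(* If the products were eventually at least [r], then [v] and the backward
   orbit would witness [product_ge]. *)
have far N : exists i j, [/\ (N <= i)%N, (N <= j)%N &
    gp o (orbit g^-1%g o i) (v j) < r].
  apply: contrapT => hN; apply: nz; apply/product_geP.
  exists (orbit g^-1%g o), v; split=> //; first exact: ideal_of_mem.
  move=> t tr; exists N => i j Ni Nj; rewrite leNgt; apply/negP => h.
  by apply: hN; exists i, j; split=> //; exact: lt_trans tr.
have near_attracting i j l : (k <= i)%N -> (k <= j)%N ->
    gp o (orbit g^-1%g o i) (v l) < r ->
    s + delta <= gp o (orbit g o j) (act (g ^+ k)%g (v l)).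
  move=> ki kj /(north_south_inner go ki kj) h; apply: le_trans (h _).
    by have := ler_norm s; have := ler_norm r; move: ak; rewrite /M /L; lra.
  by have := normr_ge0 s; have := ler_norm r; move: ak; rewrite /M /L; lra.
apply/product_geP; exists (orbit g o), (act_seq act (g ^+ k)%g v); split.
- exact: ideal_of_mem.
- exact: represents_act.
move=> t ts; case: z zv {nz} => [y /= vy|xi /= xv].
  exists k => j l kj _; have [i [l' [ki _ h]]] := far k.
  by have := near_attracting i j l' ki kj h; subst v; rewrite /act_seq; lra.
have /product_to_infinityP/(_ o (s + delta + displacement g o k))[N hN] :=
  boundary_converges xv.
exists (maxn k N) => j l; rewrite !geq_max => /andP[kj _] /andP[_ Nl].
have [i [l' []]] := far (maxn k N).
rewrite !geq_max => /andP[ki _] /andP[_ Nl'] h.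
apply: le_trans (hyperbolic_ge hypY (near_attracting i j l' ki kj h) _).
  by rewrite addrK ltW.
have := hN l' l Nl' Nl; rewrite -(gromov_product_act act_isom (g ^+ k)%g).
have := gromov_product_base o (act (g ^+ k)%g o) (act (g ^+ k)%g (v l'))
  (act (g ^+ k)%g (v l)).
by rewrite -[mdist o _]/(displacement g o k) /act_seq; lra.
Qed.

Lemma north_south g o (go : drifts g o) (U V : set (bordification Y)) :
  open U -> open V -> U (Ideal (attracting (driftsV go))) ->
  V (Ideal (attracting go)) ->
  exists k, forall z, ~ U z -> V (ext (g ^+ k)%g z).
Proof.
move=> [_ U2] [_ V2] /U2/(_ o)[r hr] /V2/(_ o)[s hs].
have [k hk] := north_south_ge go r s.
by exists k => z nUz; apply: hs; apply: hk => h; apply: nUz; exact: hr.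
Qed.

Lemma fixes_idealX g xi n :
  fixes_ideal act g xi -> ext (g ^+ n)%g (Ideal xi) = Ideal xi.
Proof.
move=> /(fixes_idealE act1 actM act_isom) h; elim: n => [|n IH].
  by rewrite expg0 act_bord1.
by rewrite expgS act_bordM IH /= h.
Qed.

(** Any other fixed ideal point would be moved into an arbitrary neighbourhood of
    the attracting point. *)
Lemma drifts_fixed_point g o (go : drifts g o) xi : fixes_ideal act g xi ->
  xi = attracting go \/ xi = attracting (driftsV go).
Proof.
move=> gxi; apply: contrapT => /not_orP[xa xr].
have [U1 [U [oU1 oU U1x Ur U1U]]] := ideal_hausdorff hypY xr.
have [V1 [V [oV1 oV V1x Va V1V]]] := ideal_hausdorff hypY xa.
have [k hk] := north_south oU oV Ur Va.
have : (V1 `&` V) (Ideal xi).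
  split=> //; rewrite -(fixes_idealX k gxi); apply: hk => Ux.
  by have : (U1 `&` U) (Ideal xi) by []; rewrite U1U.
by rewrite V1V.
Qed.

(** Otherwise doubling the exponent increases the displacement by a bounded
    amount, so the displacement of [g^(2^n)] grows at most linearly in [n], against the
    linear lower bound for the displacement of [g^n]. *)
Lemma hyperbolic_drifts g o : hyperbolic_element act g ->
  exists n, drifts (g ^+ n)%g o.
Proof.
move=> /(_ o)[lambda [c [lambda1 hg]]]; have d0 := delta_ge0 hypY o.
have l0 : 0 < lambda by lra.
have lin n : n%:R <= lambda * (displacement g o n + c).
  have /andP[+ _] := hg 0 (Posz n); rewrite /= expg0 act1 sub0r normrN /=.
  rewrite lerBlDr ler_pdivrMl//; exact.
have orbitX m n : displacement (g ^+ m)%g o n = displacement g o (m * n).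
  by rewrite /displacement /orbit expgnA.
apply: contrapT => nd; pose C := 3 * delta + 1.
have doubling n : displacement g o (2 ^ n) <= displacement g o 1 + n%:R * C.
  elim: n => [|n IH]; first by rewrite expn0 mul0r addr0.
  have : ~ drifts (g ^+ (2 ^ n))%g o by move=> h; apply: nd; exists (2 ^ n)%N.
  rewrite /drifts !orbitX muln1 mulnC -expnS => /negP; rewrite -ltNge => h.
  by rewrite -natr1 mulrDl; rewrite /C in IH *; lra.
pose A := lambda * (displacement g o 1 + c); pose B := lambda * C.
(* Evaluating at [2 ^ (2 * n)], which is at least [n * n], beats the linear bound. *)
have quad (n : nat) : (n * n)%:R <= A + 2 * n%:R * B.
  apply: le_trans (_ : (2 ^ (2 * n))%:R <= _).
    by rewrite ler_nat mul2n -addnn expnD leq_mul// ltnW// ltn_expl.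
  apply: le_trans (lin _) _; rewrite /A /B.
  have := doubling (2 * n)%N; rewrite natrM -(ler_pM2l l0); lra.
have B0 : 0 <= B by rewrite mulr_ge0 ?ltW// /C; lra.
have A0 : 0 <= A by have := quad 0; rewrite mulr0 mul0r addr0.
have h0 : 0 <= A + 2 * B + 1 by lra.
have := archi_boundP h0; set n := Num.bound _ => hn.
have := quad n; rewrite natrM.
have n1 : 1 <= (n%:R : R) by lra.
nra.
Qed.

End NorthSouth.

(** * Extreme proximality *)

Section ExtremeProximality.
Context {R : realType} {Y : metricType R} {gT : groupType}.
Variable act : gT -> Y -> Y.
Hypothesis act1 : forall y, act 1%g y = y.
Hypothesis actM : forall g h y, act (g * h)%g y = act g (act h y).
Hypothesis act_isom : forall g x y, mdist (act g x) (act g y) = mdist x y.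
Hypothesis hypY : gromov_hyperbolic Y.
Variable G : set gT.
Hypothesis G_group : subgroup G.
Local Notation ext := (act_bord act1 actM act_isom).

Lemma subgroupX g n : G g -> G (g ^+ n)%g.
Proof.
case: G_group => G1 GM _ Gg; elim: n => [|n IH]; first by rewrite expg0.
by rewrite expgS; exact: GM.
Qed.

(** The point [xi] is attracting or repelling for some power of [g], and [xi'] is
    the other fixed point of this power; in the attracting case one uses the
    inverse. *)
Lemma fixed_point_dynamics g xi : G g -> hyperbolic_element act g ->
  fixes_ideal act g xi -> exists xi', forall U V : set (bordification Y),
    open U -> open V -> U (Ideal xi) -> V (Ideal xi') ->
    exists2 h, G h & forall z, ~ U z -> V (ext h z).
Proof.
case: hypY => delta hd Gg hg gxi; have [u _] := boundary_mem xi.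
have [n gn] := hyperbolic_drifts act1 hd (u 0) hg.
have Gn : G (g ^+ n)%g by exact: subgroupX.
have fxi : fixes_ideal act (g ^+ n)%g xi.
  by apply/(fixes_idealE act1 actM act_isom);
    have [] := fixes_idealX act1 actM act_isom n gxi.
have [xia|xir] := drifts_fixed_point act1 actM act_isom hd gn fxi; last first.
  exists (attracting act1 actM act_isom hd gn) => U V oU oV Ux Vx.
  rewrite xir in Ux; have [k hk] := north_south oU oV Ux Vx.
  by exists (g ^+ n ^+ k)%g => //; exact: subgroupX.
exists (attracting act1 actM act_isom hd (driftsV act1 actM act_isom gn)).
move=> U V oU oV Ux Vx; rewrite xia in Ux.
have [k hk] := north_south oV oU Vx Ux.
exists (g ^+ n ^+ k)^-1%g.
  by case: G_group => _ _; apply; exact: subgroupX.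
move=> z nUz; apply: contrapT => nV; apply: nUz.
by have := hk _ nV; rewrite act_bordKV.
Qed.

Hypothesis G_non_elementary : non_elementary act G.
Hypothesis G_limit_set : limit_set act G = setT.

Lemma fixed_point_dense (U : set (bordification Y)) xi : open U ->
  U (Ideal xi) -> exists eta g,
    [/\ U (Ideal eta), G g, hyperbolic_element act g & fixes_ideal act g eta].
Proof.
move=> oU Uxi; have : limit_set act G xi by rewrite G_limit_set.
move=> /(_ U (open_nbhs_nbhs (conj oU Uxi)))[_ [[eta [g [Gg hg ge] <-] Ue]]].
by exists eta, g.
Qed.

(** Take hyperbolic [g] and [h] with a fixed point in [U] and in [V].  Powers push
    the complement of [U] close to the other fixed point of [g], and the complement
    of any neighbourhood of the other fixed point of [h] into [V].  If these two
    points coincide, an element of [G] moving the first one is inserted; it exists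
    because [G] has no global fixed point. *)
Lemma extremely_proximal (U V : set (bordification Y)) xi eta :
  open U -> open V -> U (Ideal xi) -> V (Ideal eta) ->
  exists2 g, G g & forall z, ~ U z -> V (ext g z).
Proof.
move=> oU oV /(fixed_point_dense oU)[{}xi [g [Uxi Gg hg gxi]]].
move=> /(fixed_point_dense oV)[{}eta [h [Veta Gh hh heta]]].
have [xi' Dg] := fixed_point_dynamics Gg hg gxi.
have [eta' Dh] := fixed_point_dynamics Gh hh heta.
have [G1 GM GV] := G_group.
have [m Gm mxe] : exists2 m, G m & act_ideal act1 actM act_isom m xi' <> eta'.
  have [e|ne] := pselect (act_ideal act1 actM act_isom 1%g xi' = eta'); last first.
    by exists 1%g.
  apply: contrapT => nm; case: G_non_elementary => _; apply.
  exists xi'; first by rewrite G_limit_set.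
  move=> m Gm; apply/(fixes_idealE act1 actM act_isom).
  have -> : act_ideal act1 actM act_isom m xi' = eta'.
    by apply: contrapT => k; apply: nm; exists m.
  by rewrite -e; have [] := act_bord1 act1 actM act_isom (Ideal xi').
case: (hypY) => delta hd.
have [P [Q [oP oQ Px Qe PQ]]] := ideal_hausdorff hd mxe.
have [g' Gg' hg'] := Dg _ _ oU (act_bord_open act1 actM act_isom m oP) Uxi Px.
have [h' Gh' hh'] := Dh _ _ oV oQ Veta Qe.
exists (h'^-1 * (m * g'))%g; first by apply: (GM _ _ (GV _ Gh')); exact: GM.
move=> z /hg' /= Pz; apply: contrapT => nV; have := hh' _ nV.
rewrite !act_bordM act_bordKV => Qz.
have : (P `&` Q) (ext m (ext g' z)) by [].
by rewrite PQ.
Qed.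

(** If [U] and [V] met the boundary in one common point only, then an element
    mapping the complement of [U] into [V] would identify the other ideal points,
    of which there are at least two. *)
Lemma ideal_points_distinct (U V : set (bordification Y)) xi eta :
  open U -> open V -> U (Ideal xi) -> V (Ideal eta) ->
  exists xi' eta', [/\ U (Ideal xi'), V (Ideal eta') & xi' <> eta'].
Proof.
move=> oU oV Uxi Veta; apply: contrapT => h.
have only xi' eta' : U (Ideal xi') -> V (Ideal eta') -> xi' = eta'.
  by move=> ? ?; apply: contrapT => ?; apply: h; exists xi', eta'.
have [g _ hg] := extremely_proximal oU oV Uxi Veta.
have out zeta : zeta <> xi -> act_ideal act1 actM act_isom g zeta = eta.
  move=> zx; have : V (ext g (Ideal zeta)).
    by apply: hg => /only /(_ Veta); rewrite -(only _ _ Uxi Veta).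
  by rewrite /= => /(only _ _ Uxi) <-; exact: only.
have inj z1 z2 : z1 <> xi -> z2 <> xi -> z1 = z2.
  move=> /out e1 /out e2.
  have [] : Ideal z1 = Ideal z2 :> bordification Y; last by [].
  rewrite -[LHS](act_bordK act1 actM act_isom g).
  by rewrite -[RHS](act_bordK act1 actM act_isom g) /= e1 e2.
case: G_non_elementary => -[z1 [z2 [z3 [_ [n12 n13 n23]]]]] _.
have [e|n1] := pselect (z1 = xi).
  by apply: n23; apply: inj; rewrite -e; exact/nesym.
have [e|n2] := pselect (z2 = xi); last exact: n12 (inj _ _ n1 n2).
by apply: n13; apply: inj => //; rewrite -e; exact/nesym.
Qed.

End ExtremeProximality.

(** * Walls and their automorphisms *)

Section WallAutomorphisms.
Variable X : wallSpace.
Implicit Types (g h m : wall_aut X) (A B : set X) (W : set (set X)).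

Lemma image_autE g A : g @` A = aut_inv g @^-1` A.
Proof.
apply/seteqP; split=> [_ [x Ax <-]|x Ax] /=; first by rewrite aut_funK.
by exists (aut_inv g x) => //; exact: aut_invK.
Qed.

Lemma half_space_wall A : half_space A -> walls [set A; ~` A].
Proof.
move=> [W MW WA]; suff -> : [set A; ~` A] = W by [].
have [B [_ _ WE]] := walls_are_walls MW; move: WA; rewrite WE => -[->|->] //.
by rewrite setCK setUC.
Qed.

Lemma half_spaceC A : half_space A -> half_space (~` A).
Proof. by move=> /half_space_wall hA; exists [set A; ~` A] => //; right. Qed.

Lemma half_space_neq0 A : half_space A -> A !=set0.
Proof.
by move=> [W /walls_are_walls[B [B0 BC0 ->]]] [->|->].
Qed.

Lemma image_half_space g A : half_space A -> half_space (g @` A).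
Proof.
move=> [W MW WA]; exists [set g @` B | B in W]; last by exists A.
exact: (aut_walls g W).1.
Qed.

Lemma image_wall2 g A :
  [set g @` B | B in [set A; ~` A]] = [set g @` A; ~` (g @` A)].
Proof.
have -> : ~` (g @` A) = g @` (~` A) by rewrite !image_autE.
apply/seteqP; split=> [_ [B [->|->] <-]|_ [->|->]]; [by left|by right| |].
  by exists A => //; left.
by exists (~` A) => //; right.
Qed.

Lemma separates2 A x y :
  separates [set A; ~` A] x y <-> (A x /\ ~ A y) \/ (~ A x /\ A y).
Proof.
split=> [[B [[->|->] Bx By]]|[[Ax Ay]|[Ax Ay]]].
- by left.
- by right; split=> //; exact: contrapT.
- by exists A; split=> //; left.
- by exists (~` A); split=> //; right.
Qed.

Lemma strictly_fixes_conj g m W : strictly_fixes g W ->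
  strictly_fixes (m * g * m^-1)%g [set m @` A | A in W].
Proof.
move=> gW x y xy [_ [[A WA <-]]]; rewrite !image_autE /= => Ax Ay.
have [e1 e2] := gW _ _ (edge_aut m^-1%g xy) (ex_intro _ A (And3 WA Ax Ay)).
by split; rewrite -[LHS]/(m (g (m^-1%g _))) ?e1 ?e2; exact: aut_invK.
Qed.

Lemma strictly_fixes1 W : strictly_fixes 1%g W.
Proof. by []. Qed.

Lemma strictly_fixesM g h W : strictly_fixes g W -> strictly_fixes h W ->
  strictly_fixes (g * h)%g W.
Proof.
move=> gW hW x y xy Wxy; have [gx gy] := gW _ _ xy Wxy.
by have [hx hy] := hW _ _ xy Wxy; split; [rewrite -{2}gx -{2}hx|rewrite -{2}gy -{2}hy].
Qed.

Lemma strictly_fixesV g W : strictly_fixes g W -> strictly_fixes g^-1%g W.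
Proof.
move=> gW x y xy Wxy; have [gx gy] := gW _ _ xy Wxy.
by split; [rewrite -{1}gx|rewrite -{1}gy]; exact: aut_funK.
Qed.

End WallAutomorphisms.

Section GraphAction.
Variables (R : realType) (X : wallSpace).
Implicit Types (g h : wall_aut X) (p q : graph R X) (x y : X).

Lemma graph_act1 p : graph_act 1%g p = p.
Proof. exact: graph_eq. Qed.

Lemma graph_actM g h p : graph_act (g * h)%g p = graph_act g (graph_act h p).
Proof. exact: graph_eq. Qed.

Lemma graph_act_vertex g x : graph_act g (vertex R x) = vertex R (g x).
Proof. by apply: graph_eq; rewrite /= indic_aut. Qed.

Lemma string_length_act g p q l : string_length p q l ->
  string_length (graph_act g p) (graph_act g q) l.
Proof.
have act_closed x y p' : closed_edge x y (sval p') ->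
    closed_edge (g x) (g y) (sval (graph_act g p')).
  by move=> [t t01 /= ->]; exists t => //; rewrite -!indic_aut.
elim=> [p'|p' q' r x y k xy hp hq _ IH]; first exact: string_nil.
have -> : sval p' x - sval q' x =
    sval (graph_act g p') (g x) - sval (graph_act g q') (g x).
  by rewrite /= aut_funK.
by apply: string_cons (act_closed _ _ _ hp) (act_closed _ _ _ hq) IH;
  exact: edge_aut.
Qed.

Lemma graph_act_isom g p q : mdist (graph_act g p) (graph_act g q) = mdist p q.
Proof.
rewrite /mdist /= /graph_dist; congr inf; apply/seteqP; split=> l /=.
  move=> /(string_length_act g^-1%g).
  by rewrite -!graph_actM mulVg !graph_act1.
exact: string_length_act.
Qed.

Lemma coord_le_mdist p q x : `|sval p x - sval q x| <= mdist p q.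
Proof.
apply: lb_le_inf; first exact: string_exists.
by move=> l; exact: string_coord.
Qed.

Lemma coord_neq0 p : exists x, sval p x != 0.
Proof.
have ind x : (\1_[set x] x : R) = 1 by rewrite indicE mem_set.
case: (svalP p) => [[x ->]|[x [y [[xy _] [t _ ->]]]]].
  by exists x; rewrite ind oner_eq0.
have ind0 (a b : X) : a <> b -> (\1_[set a] b : R) = 0.
  by move=> ab; rewrite indicE memNset// => /= ba; apply: ab.
have [t0|t0] := eqVneq t 0.
  exists x; rewrite ind (ind0 y x); last exact/nesym.
  by rewrite t0 subr0 mulr1 mul0r addr0 oner_eq0.
by exists y; rewrite ind (ind0 x y)// mulr0 add0r mulr1.
Qed.

End GraphAction.

(** * Chains and the commutator trick *)

Section Chains.
Variable X : wallSpace.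
Implicit Types (g h k : wall_aut X) (A B : set X) (C : int -> set X).

Lemma expgzS (gT : groupType) (g : gT) i :
  expgz g (i + 1) = (g * expgz g i)%g.
Proof.
case: i => [n|[|n]]; rewrite /expgz.
- by rewrite -PoszD addn1 expgS.
- by rewrite expg1 mulgV.
have -> : Negz n.+1 + 1 = Negz n by lia.
by rewrite -!expVgn [in RHS]expgS mulVKg.
Qed.

(** The walls of the [D n] would be infinitely many walls separating [x] and [y]. *)
Lemma no_infinite_separation (D : nat -> set X) x y : injective D ->
  (forall n, half_space (D n)) -> ~ forall n, D n x /\ ~ D n y.
Proof.
move=> Dinj hD Dxy; have xy : x <> y.
  by move=> e; have [+ nDy] := Dxy 0; rewrite e.
have [fin _] := walls_separate xy.
suff : finite_set [set: nat] by exact: infinite_nat.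
have -> : setT = (fun n => [set D n; ~` D n]) @^-1` separating x y.
  apply/seteqP; split=> n //= _; split; first exact: half_space_wall.
  by apply/separates2; left; exact: Dxy.
apply: finite_preimage fin => m n _ _ /seteqP[/(_ (D m)) + _].
move=> /(_ (or_introl erefl)) /= [/Dinj//|e].
by have [+ _] := Dxy m; have [Dnx _] := Dxy n; rewrite e => /(_ Dnx).
Qed.

Section OneChain.
Variable C : int -> set X.
Hypothesis chainC : chain C.

Lemma chain_homo i j : i <= j -> C j `<=` C i.
Proof.
move=> ij; have -> : j = i + `|j - i|%N%:Z by lia.
elim: `|j - i|%N => [|n IH]; first by rewrite addr0.
apply: subset_trans IH; have [_ [+ _]] := chainC (i + n%:Z).
by have -> : i + n%:Z + 1 = i + n.+1%:Z by lia.
Qed.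

Lemma chain_inj : injective C.
Proof.
have lt i j : i < j -> C i <> C j.
  move=> ij e; have [_ [_]] := chainC i; apply; rewrite e.
  by apply: chain_homo; lia.
by move=> i j e; case: (ltgtP i j) => // /lt; rewrite e => /(_ erefl).
Qed.

(** The strips between consecutive half-spaces cover the whole space: a point in
    all or in none of the half-spaces would be separated by infinitely many walls
    from any point of a strip. *)
Lemma chain_strip x : exists i, (C i `\` C (i + 1)) x.
Proof.
have [_ [_ /nonsubset[y [C0y nC1y]]]] := chainC 0.
have [b nCb] : exists b, ~ C b x.
  apply: contrapT => /forallNP h.
  apply: (@no_infinite_separation (fun n => C (n%:Z + 1)) x y).
  - by move=> m n /chain_inj; lia.
  - by move=> n; exact: (chainC _).1.
  - move=> n; split; first by apply: contrapT; exact: h.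
    by move=> Cy; apply: nC1y; apply: chain_homo Cy; lia.
have [a Ca] : exists a, C a x.
  apply: contrapT => /forallNP h.
  apply: (@no_infinite_separation (fun n => C (- n%:Z)) y x).
  - by move=> m n /chain_inj; lia.
  - by move=> n; exact: (chainC _).1.
  - by move=> n; split=> //; apply: chain_homo C0y; lia.
have ab : a <= b.
  rewrite leNgt; apply/negP => ba; apply: nCb; apply: chain_homo Ca; exact: ltW.
move: nCb; have -> : b = a + `|b - a|%N%:Z by lia.
elim: `|b - a|%N => [|n IH]; first by rewrite addr0.
have [Cn|/IH//] := pselect (C (a + n%:Z) x) => nC.
exists (a + n%:Z); split=> //.
by have -> : a + n%:Z + 1 = a + n.+1%:Z by lia.
Qed.

Variable G : set (wall_aut X).
Hypothesis G_group : subgroup G.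

Lemma chain_fixator_group : subgroup (chain_fixator G C).
Proof.
case: G_group => G1 GM GV; split.
- by split=> // i; exact: strictly_fixes1.
- move=> g h [Gg gC] [Gh hC]; split; first exact: GM.
  by move=> i; exact: strictly_fixesM.
- by move=> g [Gg gC]; split=> [|i]; [exact: GV|exact: strictly_fixesV].
Qed.

Lemma chain_fixator_conj h g n : G h -> (forall i, h @` C i = C (i + n)) ->
  chain_fixator G C g -> chain_fixator G C (h * g * h^-1)%g.
Proof.
case: G_group => [G1 GM GV] Gh hC [Gg gC]; split.
  by apply: (GM _ _ _ (GV _ Gh)); exact: GM.
move=> i; have -> : C i = h @` C (i - n) by rewrite hC subrK.
by rewrite -image_wall2; exact: strictly_fixes_conj.
Qed.

(** The equation [f = g h f h^-1] determines [f] on each strip from its values on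
    the previous one, as [h] shifts the strips; starting from the identity, the
    solution on the strip of index [i] is [(g h)^i h^-i], which strictly fixes the
    chain.  Property (P) glues these solutions. *)
Lemma chain_fixator_commutator h g : property_P G -> G h ->
  (forall i, h @` C i = C (i + 1)) -> chain_fixator G C g ->
  exists2 f, chain_fixator G C f & g = (f * h * f^-1 * h^-1)%g.
Proof.
move=> [_ PC] Gh hC gC; have [G1 GM GV] := G_group.
have [C1 CM CV] := chain_fixator_group.
have hVC i : h^-1%g @` C i = C (i + -1).
  rewrite -{1}(subrK 1 i) -hC image_autE.
  apply/seteqP; split=> [x [z Cz /(can_inj (aut_funK h)) <-] //|x Cx].
  by exists x.
pose f i := (expgz (g * h) i * (expgz h i)^-1)%g.
have fS i : f (i + 1) = (g * (h * f i * h^-1))%g.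
  by rewrite /f !expgzS invgM !mulgA.
have fP i : f i = (h^-1 * (g^-1 * f (i + 1)) * h^-1^-1)%g.
  by rewrite fS mulKg invgK !mulgA mulVg mul1g mulgVK.
have fC i : chain_fixator G C (f i).
  elim: i => [|n IH|n IH].
  - by rewrite /f /= expg0 invg1 mulg1.
  - rewrite -addn1 PoszD fS; apply: CM => //; exact: chain_fixator_conj hC IH.
  - rewrite fP; apply: (chain_fixator_conj (GV _ Gh) hVC).
    have -> : - n.+1%:Z + 1 = - n%:Z by lia.
    exact: CM (CV _ gC) IH.
have [k [kC kf]] := PC C chainC f fC.
exists k => //; have -> : (k * h * k^-1 * h^-1 = k * (h * k * h^-1)^-1)%g.
  by rewrite !invgM invgK !mulgA.
suff {1}-> : k = (g * (h * k * h^-1))%g by rewrite mulgK.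
apply: wall_aut_eq => x; have [i Cix] := chain_strip x.
rewrite (kf i x Cix) -{1}(subrK 1 i) fS.
rewrite -[LHS]/(g (h (f (i - 1) (aut_inv h x)))).
rewrite -[RHS]/(g (h (k (aut_inv h x)))) (kf (i - 1))//.
case: Cix => Cix nCx; split.
  by move: Cix; rewrite -{1}(subrK 1 i) -hC image_autE.
by move=> h'; apply: nCx; rewrite -hC image_autE /= -{1}(subrK 1 i).
Qed.

End OneChain.

Lemma translated_chain h A : half_space A -> h @` A `<` A ->
  chain (fun i => expgz h i @` A).
Proof.
move=> hA [hAA AhA] i; split; first exact: image_half_space.
have comm : (h * expgz h i = expgz h i * h)%g.
  have ch n : commute h (h ^+ n)%g by exact: commuteX.
  case: i => [n|n] /=; first exact: ch.
  by rewrite -expVgn; apply: commuteX; rewrite /commute mulVg mulgV.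
rewrite expgzS comm.
have -> : (expgz h i * h)%g @` A = expgz h i @` (h @` A).
  by rewrite image_comp.
split; first by apply: image_subset.
move=> s; apply: AhA => x Ax.
have [z hz /(can_inj (aut_funK (expgz h i))) <-] : (expgz h i @` (h @` A)) (expgz h i x).
  by apply: s; exists x.
by [].
Qed.

Lemma translated_chainS h A i : h @` (expgz h i @` A) = expgz h (i + 1) @` A.
Proof. by rewrite expgzS image_comp. Qed.

End Chains.

(** * Half-spaces at infinity *)

Section HalfSpacesAtInfinity.
Variables (R : realType) (X : wallSpace).
Implicit Types (g h k : wall_aut X) (A B V W : set X) (x y : X).
Implicit Types (p q : graph R X) (xi eta : boundary (graph R X)).
Local Notation cl := (@closure_at_infinity R X).
Local Notation ext :=
  (act_bord (@graph_act1 R X) (@graph_actM R X) (@graph_act_isom R X)).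

Definition ideal_half_space A : Prop :=
  half_space A /\ exists xi, (cl A)° (Ideal xi).

Lemma closure_at_infinityS A B : A `<=` B -> cl A `<=` cl B.
Proof.
move=> AB; apply: closure_subset; apply: image_subset => p pA x /pA; exact: AB.
Qed.

Lemma vertex_neq0 x y : sval (vertex R x) y != 0 -> y = x.
Proof.
rewrite /= indicE; have [//|ne] := pselect (y = x).
by rewrite memNset// eqxx.
Qed.

Lemma full_subgraph_vertex A x : full_subgraph A (vertex R x) <-> A x.
Proof.
split=> [|Ax y /vertex_neq0 -> //]; apply.
by rewrite /= indicE mem_set// oner_eq0.
Qed.

(** Full subgraphs are closed in the graph, as coordinates are Lipschitz. *)
Lemma closure_at_infinity_inner A p : cl A (Inner p) -> full_subgraph A p.
Proof.
move=> Ap x px; have e0 : 0 < `|sval p x| by rewrite normr_gt0.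
pose N (z : bordification (graph R X)) :=
  if z is Inner q then `|sval p x - sval q x| < `|sval p x| : Prop else False.
have oN : open N.
  split=> // q Nq.
  have r0 : 0 < `|sval p x| - `|sval p x - sval q x| by rewrite subr_gt0.
  have := @nbhsx_ballx _ (graph R X) q _ r0.
  rewrite ballEmdist; apply: filterS => q' /= qq' /=.
  have := coord_le_mdist q q' x.
  by have := ler_distD (sval q x) (sval p x) (sval q' x); lra.
have Np : N (Inner p) by rewrite /N subrr normr0.
have [_ [[q qA <-] /= Nq]] := Ap _ (open_nbhs_nbhs (conj oN Np)).
by apply: qA; apply: contraTneq Nq => ->; rewrite subr0 ltxx.
Qed.

Lemma closure_at_infinity_vertex A x : cl A (Inner (vertex R x)) <-> A x.
Proof.
split=> [/closure_at_infinity_inner/full_subgraph_vertex//|Ax].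
by apply: subset_closure; exists (vertex R x) => //; apply/full_subgraph_vertex.
Qed.

(** The interior of the closure of [A] would contain a point of the full subgraph
    of the complement of [A], whereas full subgraphs are closed in the graph. *)
Lemma closure_at_infinityC A xi : (cl A)° (Ideal xi) -> ~ cl (~` A) (Ideal xi).
Proof.
move=> Axi Cxi; have [_ [[q qC <-] /closure_at_infinity_inner qA]] := Cxi _ Axi.
by have [x qx] := coord_neq0 q; exact: qC qx (qA _ qx).
Qed.

Lemma closure_at_infinity_aut g A z : cl (g @` A) (ext g z) -> cl A z.
Proof.
move=> gAz U; rewrite nbhsE => -[U' [oU' U'z] U'U].
have oV := act_bord_open (@graph_act1 R X) (@graph_actM R X)
  (@graph_act_isom R X) g^-1%g oU'.
have Vz : (ext g^-1%g @^-1` U') (ext g z) by rewrite /preimage /= act_bordK.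
have [_ [[q qgA <-] /= Uq]] := gAz _ (open_nbhs_nbhs (conj oV Vz)).
exists (Inner (graph_act g^-1%g q)); split; last exact: U'U.
exists (graph_act g^-1%g q) => // x /= /qgA [y Ay /(can_inj (aut_funK g)) <-].
exact: Ay.
Qed.

Lemma proper_wall_aut g (M : set (set X)) : proper_wall R M ->
  proper_wall R [set g @` A | A in M].
Proof.
move=> pM _ [A MA <-] e; apply: (pM A MA); apply/seteqP; split=> // xi _.
have : (@Ideal R (graph R X) @^-1` cl (g @` A))
  (act_ideal (@graph_act1 R X) (@graph_actM R X) (@graph_act_isom R X) g xi).
  by rewrite e.
exact: (@closure_at_infinity_aut g A (Ideal xi)).
Qed.

Lemma ideal_half_space_proper V W : ideal_half_space V -> ideal_half_space W ->
  V `&` W = set0 -> proper_wall R [set W; ~` W].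
Proof.
move=> [_ [xi Vxi]] [_ [eta Weta]] VW A [->|->] e; last first.
  apply: (closure_at_infinityC Weta).
  by have : [set: boundary (graph R X)] eta by []; rewrite -e.
apply: (closure_at_infinityC Vxi).
have : [set: boundary (graph R X)] xi by [].
rewrite -e; apply: closure_at_infinityS => x Wx Vx.
by have : (V `&` W) x by []; rewrite VW.
Qed.

Hypothesis X_hyperbolic : hyperbolic_wallSpace R X.

Lemma ideal_half_space_nbhs (U : set (bordification (graph R X))) xi : open U ->
  U (Ideal xi) -> exists A, [/\ half_space A, (cl A)° (Ideal xi),
    ideal_half_space A & forall x, A x -> U (Inner (vertex R x))].
Proof.
move=> oU Uxi; have [A [hA Axi AU]] :=
  X_hyperbolic.2 xi U (open_nbhs_nbhs (conj oU Uxi)).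
exists A; split=> //; first by split=> //; exists xi.
by move=> x /closure_at_infinity_vertex; exact: AU.
Qed.

Lemma avoid_proper_half_space A :
  @Ideal R (graph R X) @^-1` cl A <> setT ->
  exists2 B, ideal_half_space B & A `&` B = set0.
Proof.
move=> pA; have [xi nxi] : exists xi, ~ cl A (Ideal xi).
  apply: contrapT => /forallNP h; apply: pA; apply/seteqP; split=> // xi _.
  by apply: contrapT; exact: h.
have oC : open (~` cl A) by apply: closed_openC; exact: closed_closure.
have [B [_ _ iB BA]] := ideal_half_space_nbhs oC nxi.
exists B => //; apply/seteqP; split=> // x [Ax /BA]; apply.
exact/closure_at_infinity_vertex.
Qed.

Lemma displaced_half_space g xi : ~ fixes_ideal (@graph_act R X) g xi ->
  exists2 B, ideal_half_space B & forall x, B x -> ~ B (g x).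
Proof.
move=> /(fixes_idealE (@graph_act1 R X) (@graph_actM R X) (@graph_act_isom R X)).
have [delta hd] := X_hyperbolic.1.
move=> /(ideal_hausdorff hd)[U [V [oU oV Ug Vxi UV]]].
have oU' := act_bord_open (@graph_act1 R X) (@graph_actM R X)
  (@graph_act_isom R X) g oU.
have [B [_ _ iB BUV]] := ideal_half_space_nbhs (openI oU' oV) (conj Ug Vxi).
exists B => // x Bx Bgx; have [Ugx _] := BUV x Bx; have [_ Vgx] := BUV _ Bgx.
have : (U `&` V) (Inner (vertex R (g x))).
  by split=> //; rewrite -graph_act_vertex.
by rewrite UV.
Qed.

Section NonElementary.
Variable G : set (wall_aut X).
Hypotheses (G_group : subgroup G)
  (G_non_elementary : non_elementary (@graph_act R X) G)
  (G_limit_set : limit_set (@graph_act R X) G = setT).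

(** Extreme proximality of the action at infinity, tested on the vertices of ideal
    half-spaces. *)
Definition compresses (N : set (wall_aut X)) : Prop :=
  forall V W, ideal_half_space V -> ideal_half_space W ->
    exists2 g, N g & forall x, ~ V x -> W (g x).

Lemma non_elementary_compresses : compresses G.
Proof.
move=> V W [hV [xi Vxi]] [hW [eta Weta]].
have [g Gg hg] := extremely_proximal (@graph_act1 R X) (@graph_actM R X)
  (@graph_act_isom R X) X_hyperbolic.1 G_group G_non_elementary G_limit_set
  (open_interior (cl V)) (open_interior (cl W)) Vxi Weta.
exists g => // x nVx; apply/closure_at_infinity_vertex; apply: interior_subset.
rewrite -graph_act_vertex; apply: (hg (Inner (vertex R x))).
by move=> /interior_subset/closure_at_infinity_vertex.
Qed.

(** This is where the absence of isolated ideal points is used. *)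
Lemma disjoint_ideal_half_spaces V W :
  ideal_half_space V -> ideal_half_space W -> exists V' W',
  [/\ ideal_half_space V', ideal_half_space W', V' `<=` V, W' `<=` W &
      V' `&` W' = set0].
Proof.
move=> [hV [xi Vxi]] [hW [eta Weta]].
have [xi' [eta' [{}Vxi {}Weta xe]]] := ideal_points_distinct (@graph_act1 R X)
  (@graph_actM R X) (@graph_act_isom R X) X_hyperbolic.1 G_group
  G_non_elementary G_limit_set
  (open_interior (cl V)) (open_interior (cl W)) Vxi Weta.
have [delta hd] := X_hyperbolic.1.
have [P [Q [oP oQ Px Qe PQ]]] := ideal_hausdorff hd xe.
have [V' [_ _ iV' V'P]] := ideal_half_space_nbhs
  (openI oP (open_interior (cl V))) (conj Px Vxi).
have [W' [_ _ iW' W'Q]] := ideal_half_space_nbhs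
  (openI oQ (open_interior (cl W))) (conj Qe Weta).
exists V', W'; split=> //.
- by move=> x /V'P[_ /interior_subset/closure_at_infinity_vertex].
- by move=> x /W'Q[_ /interior_subset/closure_at_infinity_vertex].
- apply/seteqP; split=> // x [/V'P[Px' _] /W'Q[Qx' _]].
  have : (P `&` Q) (Inner (vertex R x)) by [].
  by rewrite PQ.
Qed.

(** One may assume [V] and [W] disjoint.  Conjugating [k] by an element of [N] that
    maps the complement of [W] into [B] gives [k'] in [K] with [k' V] contained in
    [W]; with [g] in [N] mapping the complement of [V] into [V], the commutator of
    [k'] and [g] is as required. *)
Lemma compresses_normalised (N K : set (wall_aut X)) k B :
  subgroup N -> subgroup K -> (forall h n, K h -> N n -> K (h ^ n)%g) ->
  compresses N -> K k -> ideal_half_space B -> (forall x, B x -> ~ B (k x)) ->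
  compresses K.
Proof.
move=> [_ _ NV] [_ KM KV] KN cN Kk iB kB V0 W0 iV0 iW0.
have [V [W [iV iW VV0 WW0 VW]]] := disjoint_ideal_half_spaces iV0 iW0.
have disj x : V x -> ~ W x.
  by move=> Vx Wx; have : (V `&` W) x by []; rewrite VW.
(* In [k ^ m], [m] first sends [V], which lies off [W], into [B]. *)
have [m Nm hm] := cN _ _ iW iB.
pose k' := (k ^ m)%g; have Kk' : K k' by exact: KN.
have k'V x : V x -> W (k' x).
  move=> Vx; apply: contrapT => /hm.
  rewrite -[k' x]/(aut_inv m (k (m x))) aut_invK; apply: kB; apply: hm.
  exact: disj.
have [g Ng hg] := cN _ _ iV iV.
exists (k' * (k'^-1 ^ g^-1))%g; first by apply: KM (KN _ _ (KV _ Kk') (NV _ Ng)).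
move=> x nV0x; apply: WW0; set y := aut_inv g x.
have Vy : V y.
  apply: contrapT => /hg; rewrite /y aut_invK => /VV0; exact: nV0x.
change (W (k' (g (aut_inv k' y)))).
apply: (k'V _); apply: hg => Vk'y; apply: (disj _ Vy).
by have := k'V _ Vk'y; rewrite aut_invK.
Qed.

End NonElementary.
End HalfSpacesAtInfinity.

(** * Strict fixators and simplicity *)

Lemma generated_group (gT : groupType) (S : set gT) : subgroup (generated S).
Proof.
split=> [M [[]]//|g h Sg Sh M MS|g Sg M MS].
  by have [[_ MM _] _] := MS; exact: MM (Sg _ MS) (Sh _ MS).
by have [[_ _ MV] _] := MS; exact: MV (Sg _ MS).
Qed.

Section StrictFixators.
Variables (R : realType) (X : wallSpace) (G : set (wall_aut X)).
Hypothesis G_group : subgroup G.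
Implicit Types (g h m : wall_aut X) (A W : set X).

Lemma strict_fixator_Gplus M g : walls M -> proper_wall R M ->
  strict_fixator G M g -> Gplus R G g.
Proof. by move=> MM pM gM K [_ SK]; apply: SK; exists M. Qed.

Lemma Gplus_sub : Gplus R G `<=` G.
Proof. by move=> g; apply; split=> // h [M _ []]. Qed.

Lemma Gplus_conj g m : Gplus R G g -> G m -> Gplus R G (g ^ m)%g.
Proof.
have [G1 GM GV] := G_group.
have [P1 PM PV] := @generated_group _ (\bigcup_(W in [set W | walls W /\
  proper_wall R W]) strict_fixator G W).
move=> Pg Gm; apply: (Pg [set h | Gplus R G (h ^ m)%g]); split.
  split=> /= [|h k Ph Pk|h Ph]; first by rewrite conj1g.
    by rewrite conjMg; exact: PM.
  by rewrite conjVg; exact: PV.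
move=> h [M [MM pM] [Gh hM]] /=.
have Me : walls [set m^-1%g @` A | A in M] by exact: (aut_walls m^-1%g M).1.
apply: (strict_fixator_Gplus Me); first exact: proper_wall_aut.
have -> : (h ^ m = m^-1 * h * m^-1^-1)%g by rewrite invgK conjgE mulgA.
split; last exact: strictly_fixes_conj.
by apply: (GM _ _ _ (GV _ (GV _ Gm))); apply: GM => //; exact: GV.
Qed.

(** An edge transverse to the wall of [B] does not lie in [A], so it lies off [A] or
    is transverse to the wall of [A]. *)
Lemma supported_strictly_fixes A B g : strict_fixator G [set A; ~` A] g ->
  (forall x, ~ A x -> g x = x) -> A `<=` B \/ A `&` B = set0 ->
  strictly_fixes g [set B; ~` B].
Proof.
move=> [_ gA] gid AB x y xy Bxy.
have [Ax|nAx] := pselect (A x); have [Ay|nAy] := pselect (A y).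
- exfalso; have /separates2 := Bxy.
  have disj z : A z -> A `&` B = set0 -> ~ B z.
    by move=> Az AB0 Bz; have : (A `&` B) z by []; rewrite AB0.
  case: AB => AB; last by case=> -[]; [move=> /(disj _ Ax AB)|move=> _ /(disj _ Ay AB)].
  by case=> -[Bx By]; [apply: By|apply: Bx]; exact: AB.
- by apply: gA => //; apply/separates2; left.
- by apply: gA => //; apply/separates2; right.
- by rewrite !gid.
Qed.

End StrictFixators.

Section Supported.
Variables (R : realType) (X : wallSpace) (G H : set (wall_aut X)).
Hypotheses (G_group : subgroup G) (G_P : property_P G)
  (H_normal : normal_subgroup H (Gplus R G)).
Implicit Types (g h : wall_aut X) (A W : set X).

(** The chain [h^i W] is translated by [h], and [A] lies in each of its half-spaces
    of negative index and off the others; hence [g] is a commutator of [h] with an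
    element of [G^+]. *)
Lemma supported_in_normal A W g h :
  half_space A -> half_space W -> proper_wall R [set W; ~` W] ->
  A `&` W = set0 -> H h -> (forall x, A x \/ W x -> W (h x)) ->
  strict_fixator G [set A; ~` A] g -> (forall x, ~ A x -> g x = x) -> H g.
Proof.
move=> hA hW pW AW Hh hAW gA gid; have [H_group HP HJ] := H_normal.
have [H1 HM HV] := H_group; have [P1 PM PV] := generated_group _ : subgroup (Gplus R G).
have disj x : A x -> ~ W x.
  by move=> Ax Wx; have : (A `&` W) x by []; rewrite AW.
have hWW : h @` W `<` W.
  split=> [_ [x Wx <-]|Wh]; first by apply: hAW; right.
  have [x Ax] := half_space_neq0 hA.
  have [|y Wy /(can_inj (aut_funK h)) yx] := Wh (h x); first by apply: hAW; left.
  by apply: (disj x Ax); rewrite -yx.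
have chainC := translated_chain hW hWW.
set C := fun i => expgz h i @` W in chainC.
have Gh : G h by exact: Gplus_sub (HP _ Hh).
have C0 : C 0 = W by exact: image_id.
have gC : chain_fixator G C g.
  split=> [|i]; first exact: gA.1.
  apply: (supported_strictly_fixes gA gid).
  have [i0|i0] := leP 0 i.
    right; apply/seteqP; split=> // x [Ax Cx]; apply: (disj x Ax).
    by rewrite -C0; exact: (chain_homo chainC i0).
  left=> x Ax; have : C (-1) x.
    exists (h x); first by apply: hAW; left.
    by rewrite /expgz; exact: (aut_funK h).
  by apply: (chain_homo chainC); lia.
have [f fC ->] := chain_fixator_commutator chainC G_group G_P Gh
  (fun i => translated_chainS h W i) gC.
have Pf : Gplus R G f.
  apply: (strict_fixator_Gplus (half_space_wall hW) pW).
  by split; [exact: fC.1|rewrite -C0; exact: fC.2].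
apply: (HM _ _ _ (HV _ Hh)).
have -> : (f * h * f^-1 = h ^ f^-1)%g by rewrite conjgE invgK mulgA.
by apply: HJ => //; exact: PV.
Qed.

End Supported.

Theorem mainTheorem9 (R : realType) (X : wallSpace)
  (X_hyperbolic : hyperbolic_wallSpace R X)
  (X_geodesics : joined_by_geodesics (graph R X))
  (G : set (wall_aut X)) (G_group : subgroup G)
  (G_non_elementary : non_elementary (@graph_act R X) G)
  (G_limit_set : limit_set (@graph_act R X) G = setT)
  (G_P : property_P G)
  (H : set (wall_aut X)) (H_normal : normal_subgroup H (Gplus R G)) :
  H `<=` boundary_kernel (@graph_act R X) (Gplus R G) \/ H = Gplus R G.
Proof.
have [H_group HP HJ] := H_normal.
have [?|nH] := pselect (H `<=` boundary_kernel (@graph_act R X) (Gplus R G)).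
  by left.
right; apply/seteqP; split=> //.
have [k Hk [xi kxi]] : exists2 k, H k &
    exists xi, ~ fixes_ideal (@graph_act R X) k xi.
  apply: contrapT => h; apply: nH => k Hk; split; first exact: HP.
  by move=> xi; apply: contrapT => kxi; apply: h; exists k => //; exists xi.
have [B iB kB] := displaced_half_space X_hyperbolic kxi.
have P_group : subgroup (Gplus R G) by exact: generated_group.
have cG := non_elementary_compresses X_hyperbolic G_group G_non_elementary
  G_limit_set.
have cP : compresses R (Gplus R G).
  apply: (compresses_normalised X_hyperbolic G_group G_non_elementary G_limit_set
    G_group P_group _ cG (HP _ Hk) iB kB).
  by move=> h n; exact: Gplus_conj.
have cH : compresses R H.
  exact: (compresses_normalised X_hyperbolic G_group G_non_elementary G_limit_set
    P_group H_group HJ cP Hk iB kB).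
have supp A g : half_space A -> @Ideal R (graph R X) @^-1` closure_at_infinity A
    <> setT -> strict_fixator G [set A; ~` A] g ->
    (forall x, ~ A x -> g x = x) -> H g.
  move=> hA /(avoid_proper_half_space X_hyperbolic)[B' iB' AB'].
  have [V [W [iV iW VB WB VW]]] := disjoint_ideal_half_spaces X_hyperbolic
    G_group G_non_elementary G_limit_set iB' iB'.
  have [h Hh hVW] := cH _ _ iV iW.
  have disj (P Q : set X) x : P `&` Q = set0 -> P x -> ~ Q x.
    by move=> PQ Px Qx; have : (P `&` Q) x by []; rewrite PQ.
  apply: (supported_in_normal G_group G_P H_normal hA iW.1 _ _ Hh).
  - exact: ideal_half_space_proper iV iW VW.
  - by apply/seteqP; split=> // x [/(disj _ _ _ AB') + /WB].
  - move=> x AWx; apply: hVW => Vx; case: AWx => [Ax|Wx].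
      exact: disj AB' Ax (VB _ Vx).
    exact: disj VW Vx Wx.
move=> g; apply; split=> // {}g [M [MM pM] gM].
have [A [A0 AC0 ME]] := walls_are_walls MM; rewrite ME in MM pM gM.
have hA : half_space A by exists [set A; ~` A] => //; left.
have one : strict_fixator G [set A; ~` A] 1%g.
  by split; [case: G_group|exact: strictly_fixes1].
have [a [aM aA aAC]] := G_P.1 A hA g 1%g gM one.
have [b [bM bA bAC]] := G_P.1 A hA 1%g g one gM.
have bid x : A x -> b x = x by move=> /bA.
have aid x : ~ A x -> a x = x by move=> /aAC.
have Ha : H a by apply: (supp A) => //; apply: pM; left.
have Hb : H b.
  apply: (supp (~` A)) => //.
  - exact: half_spaceC.
  - by apply: pM; right.
  - by rewrite setCK setUC.
  - by move=> x /contrapT; exact: bid.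
suff -> : g = (a * b)%g by case: H_group => _ HM _; exact: HM.
apply: wall_aut_eq => x; rewrite -[RHS]/(a (b x)).
have [Ax|nAx] := pselect (A x); first by rewrite bid// aA.
rewrite bAC// aid//.
move=> Agx.
have := bid _ Agx; rewrite -(bAC x nAx) => /(can_inj (aut_funK b)) e.
by apply: (nAx); rewrite -e bAC.
Qed.
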